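(* Let $\mathcal{N}=\{N_k,\mathcal{H}:k\ge0\}$ be a nest of order type $\omega$ with finite dimensional atoms of rank $n_k=\dim(N_k\ominus N_{k-1})$ for $k\ge1$. Suppose that the sequence $(n_k)$ is monotone increasing: $n_{k+1}\ge n_k$ for $k\ge1$. Define $d_j=\big|\{k:2^{j-1}<n_k\le2^j\}\big|$ for $j\ge0$. (i) If $\sup d_j=\infty$, then $\mathrm{rtsr}(\mathcal{T}(\mathcal{N}))=\infty$. (ii) If $\sup d_j<\infty$, then $\mathrm{rtsr}(\mathcal{T}(\mathcal{N}))=2$.
   Context: A nest of order type $\omega$ on a Hilbert space $\mathcal{H}$ is a family $\mathcal{N}=\{N_k,\mathcal{H}:k\ge0\}$ of closed subspaces with $\{0\}=N_0<N_1<N_2<\cdots$ and $\bigcup_k N_k$ dense in $\mathcal{H}$; its atoms are $A_k=N_k\ominus N_{k-1}$, $k\ge1$. The nest algebra $\mathcal{T}(\mathcal{N})$ is the algebra of all $T\in\mathcal{B}(\mathcal{H})$ with $TN\subset N$ for every $N\in\mathcal{N}$. For a unital Banach algebra $\mathfrak{A}$, $\mathrm{rtsr}(\mathfrak{A})$ (right topological stable rank) is the least positive integer $n$ such that the set of $(a_1,\dots,a_n)\in\mathfrak{A}^n$ for which there is $(b_1,\dots,b_n)\in\mathfrak{A}^n$ with $\sum_{i=1}^n a_ib_i=1$ is dense in $\mathfrak{A}^n$; it is $\infty$ if no such $n$ exists. *)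

(* Defs.v *)
From HB Require Import structures.
From mathcomp Require Import all_boot all_order all_algebra.
From mathcomp Require Import all_classical all_reals all_analysis.
From mathcomp Require Import sesquilinear.
From mathcomp Require Import complex.

Set Implicit Arguments.
Unset Strict Implicit.
Unset Printing Implicit Defensive.

Import Order.TTheory GRing.Theory Num.Theory Num.Def.
Import numFieldNormedType.Exports.
Local Open Scope classical_set_scope.
Local Open Scope complex_scope.
Local Open Scope ring_scope.

(* A record over the normed module rather than a structure joining it with a
   ring: Num.NumDomain already joins norms with rings, so no other structure
   may. *)
Record unital_banach_algebra (K : numFieldType) := UnitalBanachAlgebra {
  ba_space :> completeNormedModType K;
  ba_one : ba_space;
  ba_mul : ba_space -> ba_space -> ba_space;
  ba_mulA : associative ba_mul;
  ba_mul1 : left_id ba_one ba_mul;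
  ba_mulr1 : right_id ba_one ba_mul;
  ba_mulDl : left_distributive ba_mul +%R;
  ba_mulDr : right_distributive ba_mul +%R;
  ba_scaleAl : forall (k : K) x y, k *: ba_mul x y = ba_mul (k *: x) y;
  ba_scaleAr : forall (k : K) x y, k *: ba_mul x y = ba_mul x (k *: y);
  ba_normM : forall x y, `|ba_mul x y| <= `|x| * `|y|
}.

Section rtsr.
Context {R : realType} (A : unital_banach_algebra R[i]).

Definition right_unimodular (n : nat) : set 'rV[A]_n :=
  [set a | exists b : 'rV[A]_n,
     \sum_(i < n) ba_mul (a ord0 i) (b ord0 i) = ba_one A].

(* Density is for the product topology on n-tuples, taken as row vectors. *)
Definition rtsr_bound (n : nat) : Prop :=
  (0 < n)%N /\ dense (@right_unimodular n).

Definition rtsr : \bar R :=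
  if pselect (exists n, `[< rtsr_bound n >]) is left ex
  then (ex_minn ex)%:R%:E else +oo%E.

End rtsr.

Section hilbert.
Context {R : realType} (H : completeNormedModType R[i]).

(* A complex Hilbert space is a complete normed space over R[i] whose norm comes
   from an inner product, linear in its first argument. *)
Definition hilbert_product (dot : {dot H for conjC}) : Prop :=
  forall x : H, `|x| ^+ 2 = dot x x.

Definition linear_subspace (E : set H) : Prop :=
  E 0 /\ forall (a : R[i]) (x y : H), E x -> E y -> E (a *: x + y).

Record omega_nest := OmegaNest {
  nest_subspace :> nat -> set H;
  nest_linear : forall k, linear_subspace (nest_subspace k);
  nest_closed : forall k, closed (nest_subspace k);
  nest_0 : nest_subspace 0%N = [set 0];
  nest_lt : forall k, nest_subspace k `<` nest_subspace k.+1;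
  nest_dense : dense (\bigcup_k nest_subspace k)
}.

Definition nest_family (N : omega_nest) : set (set H) :=
  range N `|` [set setT].

(* N_k (-) N_(k-1), for k >= 1. *)
Definition atom (dot : {dot H for conjC}) (N : omega_nest) (k : nat) : set H :=
  [set x | N k x /\ forall y, N k.-1 y -> dot x y = 0].

Definition has_dim (E : set H) (n : nat) : Prop :=
  exists e : 'I_n -> H,
    (forall c : 'I_n -> R[i], \sum_i c i *: e i = 0 -> forall i, c i = 0) /\
    E = [set \sum_i c i *: e i | c in [set: 'I_n -> R[i]]].

Definition op_bounds (T : H -> H) : set R :=
  [set M | 0 <= M /\ forall x, `|T x| <= M%:C * `|x|].

Definition bounded_operator (T : H -> H) : Prop :=
  linear T /\ op_bounds T !=set0.

Definition opnorm (T : H -> H) : R[i] := (inf (op_bounds T))%:C.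

Definition in_nest_algebra (N : omega_nest) : {pred H -> H} :=
  fun T => `[< bounded_operator T /\
               forall E, nest_family N E -> T @` E `<=` E >].

(* Two operators are equal as soon as they are equal as functions, since
   membership is a boolean. *)
Record nest_algebra (N : omega_nest) := NestOp {
  nest_op :> H -> H;
  nest_opP : nest_op \in in_nest_algebra N
}.

End hilbert.

Section nest_algebra_banach.
Context {R : realType} (H : completeNormedModType R[i]) (N : omega_nest H).
Local Notation A := (nest_algebra N).

HB.instance Definition _ := [isSub for @nest_op R H N].
HB.instance Definition _ := [Choice of A by <:].

Lemma ge0_Re (c : R[i]) : 0 <= c -> (complex.Re c)%:C = c.
Proof. by case: c => a b; rewrite lecE /= => /andP[/eqP -> _]. Qed.

Lemma Re_ge0 (c : R[i]) : 0 <= c -> 0 <= complex.Re c.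
Proof. by case: c => a b; rewrite lecE /= => /andP[_]. Qed.

Lemma norm_Re (V : normedModType R[i]) (x : V) :
  `|x| = (complex.Re `|x|)%:C.
Proof. by rewrite ge0_Re. Qed.

Lemma op_bounds_lb (T : H -> H) : has_lbound (op_bounds T).
Proof. by exists 0 => M []. Qed.

Lemma opnorm_ge0 (T : H -> H) : 0 <= opnorm T.
Proof.
rewrite /opnorm lecR.
have [/eqP->|/set0P h] := boolP (op_bounds T == set0); first by rewrite inf0.
by apply: lb_le_inf => // M [].
Qed.

Lemma opnorm_le (T : H -> H) (M : R) : op_bounds T M -> opnorm T <= M%:C.
Proof. by move=> hM; rewrite lecR; apply: ge_inf => //; exact: op_bounds_lb. Qed.

Lemma le_opnorm (T : H -> H) (x : H) :
  op_bounds T !=set0 -> `|T x| <= opnorm T * `|x|.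
Proof.
move=> h; rewrite /opnorm (norm_Re (T x)) (norm_Re x) -rmorphM /= lecR.
set t := complex.Re _; set r := complex.Re _.
have tr M : op_bounds T M -> t <= M * r.
  move=> [_ /(_ x)]; rewrite (norm_Re (T x)) (norm_Re x) -rmorphM /= lecR.
  exact.
have r0 : 0 <= r by apply: Re_ge0.
have [r00|rn0] := eqVneq r 0.
  by have [M /tr] := h; rewrite r00 !mulr0.
have rp : 0 < r by rewrite lt_neqAle eq_sym rn0.
rewrite -ler_pdivrMr //; apply: lb_le_inf => // M /tr.
by rewrite ler_pdivrMr.
Qed.

Lemma in_nest_algebraP (T : H -> H) :
  reflect (bounded_operator T /\ forall k x, N k x -> N k (T x))
          (T \in in_nest_algebra N).
Proof.
apply: (iffP (asboolP _)) => -[bT hT]; split => //.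
  move=> k x Nx; apply: (hT (N k)); first by left; exists k.
  by exists x.
by move=> E [[k _ <-]|->] // _ [x Nx <-]; exact: hT.
Qed.

Lemma in_nest_algebra_submod : submod_closed (in_nest_algebra N).
Proof.
split.
  apply/in_nest_algebraP; split; last by move=> k x _; case: (nest_linear N k).
  split; first by move=> a x y; rewrite /= scaler0 addr0.
  by exists 0; split => // x; rewrite normr0 mul0r.
move=> a S T /in_nest_algebraP[[lS [M [M0 bM]]] iS].
move=> /in_nest_algebraP[[lT [M' [M'0 bM']]] iT].
apply/in_nest_algebraP; split; last first.
  by move=> k x Nx; apply: (proj2 (nest_linear N k)); [exact: iS|exact: iT].
split.
  move=> b x y; rewrite !fctE lS lT !scalerDr !scalerA.
  by rewrite [b * a]mulrC addrACA.
exists (complex.Re `|a| * M + M'); split.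
  by rewrite addr_ge0 // mulr_ge0 // Re_ge0.
have -> : (complex.Re `|a| * M + M')%:C = `|a| * M%:C + M'%:C.
  by rewrite -[in RHS](ge0_Re (normr_ge0 a)) rmorphD rmorphM.
move=> x; rewrite mulrDl.
apply: (le_trans (ler_normD _ _)); apply: lerD => //.
by rewrite normrZ -mulrA ler_wpM2l.
Qed.

HB.instance Definition _ :=
  GRing.isSubmodClosed.Build R[i] (H -> H) (in_nest_algebra N)
    in_nest_algebra_submod.
HB.instance Definition _ := [SubChoice_isSubZmodule of A by <:].
HB.instance Definition _ := [SubZmodule_isSubLmodule of A by <:].

Lemma nest_op_bounded (T : A) : op_bounds T !=set0.
Proof. by case/in_nest_algebraP: (nest_opP T) => -[]. Qed.

Lemma nest_op_linear (T : A) : linear T.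
Proof. by case/in_nest_algebraP: (nest_opP T) => -[]. Qed.

Lemma nest_op_invariant (T : A) k x : N k x -> N k (T x).
Proof. by case/in_nest_algebraP: (nest_opP T) => _; apply. Qed.

Lemma nest_op_ext (S T : A) : (forall x, S x = T x) -> S = T.
Proof. by move=> ST; apply: val_inj; apply: funext. Qed.

Lemma nest_opD (S T : A) x : (S + T) x = S x + T x. Proof. by []. Qed.
Lemma nest_opN (T : A) x : (- T) x = - T x. Proof. by []. Qed.
Lemma nest_opZ a (T : A) x : (a *: T) x = a *: T x. Proof. by []. Qed.

Lemma op_boundsP (T : H -> H) (M : R[i]) : 0 <= M ->
  (forall x, `|T x| <= M * `|x|) -> op_bounds T (complex.Re M).
Proof.
by move=> M0 h; split => [|x]; [exact: Re_ge0|rewrite ge0_Re].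
Qed.

Lemma opnorm_leC (T : H -> H) (M : R[i]) : 0 <= M ->
  (forall x, `|T x| <= M * `|x|) -> opnorm T <= M.
Proof.
move=> M0 h; have /opnorm_le/le_trans := op_boundsP M0 h; apply.
by rewrite ge0_Re.
Qed.

Lemma nest_normD (S T : A) : opnorm (S + T : A) <= opnorm S + opnorm T.
Proof.
apply: opnorm_leC => [|x]; first by rewrite addr_ge0 ?opnorm_ge0.
rewrite nest_opD mulrDl (le_trans (ler_normD _ _))//.
by rewrite lerD ?le_opnorm//; exact: nest_op_bounded.
Qed.

Lemma nest_normZ_le (a : R[i]) (T : A) :
  opnorm (a *: T : A) <= `|a| * opnorm T.
Proof.
apply: opnorm_leC => [|x]; first by rewrite mulr_ge0 ?opnorm_ge0.
rewrite nest_opZ normrZ -mulrA ler_wpM2l// le_opnorm//.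
exact: nest_op_bounded.
Qed.

Lemma nest_normZ (a : R[i]) (T : A) : opnorm (a *: T : A) = `|a| * opnorm T.
Proof.
apply/eqP; rewrite eq_le nest_normZ_le /=.
have [->|a0] := eqVneq a 0; first by rewrite normr0 mul0r opnorm_ge0.
have := nest_normZ_le a^-1 (a *: T).
by rewrite scalerA mulVf// scale1r normfV ler_pdivlMl ?normr_gt0.
Qed.

Lemma nest_norm0_eq0 (T : A) : opnorm T = 0 -> T = 0.
Proof.
move=> T0; apply: nest_op_ext => x; apply/eqP; rewrite -normr_le0.
by rewrite (le_trans (le_opnorm _ (nest_op_bounded T)))// T0 mul0r.
Qed.

HB.instance Definition _ := Lmodule_isNormed.Build R[i] A
  nest_normD nest_normZ nest_norm0_eq0.

Lemma nest_normE (T : A) : `|T| = opnorm T. Proof. by []. Qed.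

Lemma nest_op_le (T : A) x : `|T x| <= `|T| * `|x|.
Proof. by rewrite nest_normE le_opnorm//; exact: nest_op_bounded. Qed.

Lemma nest_complete (F : set_system A) :
  ProperFilter F -> cauchy F -> cvg F.
Proof.
move=> FF Fc.
have Fe (e : R[i]) : 0 < e ->
    exists2 P : set A, F P & forall S T : A, P S -> P T -> `|S - T| < e.
  move=> e0; have e20 : 0 < e / 2 by rewrite divr_gt0.
  have /cauchyP/(_ _ e20)[T0 FT0] := Fc.
  exists (ball T0 (e / 2)) => // S T.
  rewrite -!ball_normE /ball_ /= => TS TT.
  by rewrite (@distm_lt_split _ _ T0)// distrC.
pose ev (x : H) (T : A) := T x.
have evc x : cauchy (ev x @ F).
  apply: cauchy_exP => e e0.
  have x10 : 0 < `|x| + 1 by rewrite ltr_wpDl.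
  have [P FP hP] := Fe _ (divr_gt0 e0 x10).
  have [S PS] := filter_ex FP.
  exists (S x); change (F (ev x @^-1` ball (S x) e)).
  apply: filterS FP => T PT.
  rewrite /preimage /= -ball_normE /ball_ /= /ev -[S x - T x]/((S - T) x).
  rewrite (le_lt_trans (nest_op_le _ _))//.
  rewrite (@le_lt_trans _ _ (`|S - T| * (`|x| + 1)))//.
    by rewrite ler_wpM2l// lerDl.
  by rewrite -ltr_pdivlMr// hP.
pose g x := lim (ev x @ F).
have gE x : ev x @ F --> g x by apply: cauchy_cvg.
have gle (P : set A) (e : R[i]) (S : A) : F P ->
    (forall T, P T -> `|S - T| < e) -> forall x, `|S x - g x| <= e * `|x|.
  move=> FP hP x; apply/ler_addgt0Pr => d d0.
  have /cvgrPdist_lt/(_ _ d0) hd := gE x.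
  have [T [PT /= Td]] := filter_ex (filterI FP hd).
  rewrite (le_trans (ler_distD (T x) _ _))// lerD//; last first.
    by rewrite distrC ltW.
  rewrite -[S x - T x]/((S - T) x) (le_trans (nest_op_le _ _))//.
  by rewrite ler_wpM2r// ltW// hP.
have glin : linear g.
  move=> a x y; have h := cvgD (cvgZl_tmp (k := a) (gE x)) (gE y).
  have E : ev (a *: x + y) = (a \*: ev x) + ev y.
    by apply/funext => T; exact: nest_op_linear.
  have := gE (a *: x + y); rewrite E => h'.
  exact: norm_cvg_unique h' (h _ _).
have gin : g \in in_nest_algebra N.
  apply/in_nest_algebraP; split; last first.
    move=> k x Nx; apply: (@closed_cvg _ _ F _ (ev x) (N k)
      (@nest_closed _ _ N k) _ (g x) (gE x)).
    by apply: nearW => T; exact: nest_op_invariant.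
  split=> //.
  have [P FP hP] := Fe _ (ltr01 : 0 < 1 :> R[i]).
  have [S PS] := filter_ex FP.
  exists (complex.Re (1 + `|S|)); apply: op_boundsP => [|x].
    by rewrite addr_ge0.
  rewrite -(subrK (S x) (g x)) (le_trans (ler_normD _ _))// mulrDl lerD//.
    by rewrite distrC; apply: (gle P) => // T; exact: hP.
  exact: nest_op_le.
pose G : A := NestOp gin.
apply/cvg_ex; exists G; apply/cvgrPdist_le => e e0.
have [P FP hP] := Fe _ e0.
apply: (filterS _ FP) => S PS; rewrite distrC nest_normE.
apply: opnorm_leC => [|x]; first exact: ltW.
by rewrite nest_opD nest_opN; apply: (gle P) => // T; exact: hP.
Qed.

HB.instance Definition _ := Uniform_isComplete.Build A nest_complete.

Lemma id_in_nest_algebra : idfun \in in_nest_algebra N.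
Proof.
apply/in_nest_algebraP; split => //; split => //.
by exists 1; split => // x; rewrite mul1r.
Qed.

Lemma comp_in_nest_algebra (S T : A) : S \o T \in in_nest_algebra N.
Proof.
apply/in_nest_algebraP; split; last first.
  by move=> k x Nx /=; do 2 apply: nest_op_invariant.
split; first by move=> a x y /=; rewrite !nest_op_linear.
exists (complex.Re (`|S| * `|T|)); apply: op_boundsP => [|x].
  by rewrite mulr_ge0.
by rewrite -mulrA (le_trans (nest_op_le S (T x)))// ler_wpM2l// nest_op_le.
Qed.

Definition nest_one : A := NestOp id_in_nest_algebra.
Definition nest_mul (S T : A) : A := NestOp (comp_in_nest_algebra S T).

Lemma nest_normM (S T : A) : `|nest_mul S T| <= `|S| * `|T|.
Proof.
rewrite [leLHS]nest_normE; apply: opnorm_leC => [|x]; first by rewrite mulr_ge0.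
by rewrite -mulrA (le_trans (nest_op_le S (T x)))// ler_wpM2l// nest_op_le.
Qed.

Lemma nest_mulA : associative nest_mul.
Proof. by move=> S T U; apply: nest_op_ext. Qed.

Lemma nest_mul1 : left_id nest_one nest_mul.
Proof. by move=> T; apply: nest_op_ext. Qed.

Lemma nest_mulr1 : right_id nest_one nest_mul.
Proof. by move=> T; apply: nest_op_ext. Qed.

Lemma nest_mulDl : left_distributive nest_mul +%R.
Proof. by move=> S T U; apply: nest_op_ext. Qed.

Lemma nest_mulDr : right_distributive nest_mul +%R.
Proof.
move=> S T U; apply: nest_op_ext => x.
have := nest_op_linear S 1 (T x) (U x); rewrite !scale1r; exact.
Qed.

Lemma nest_scaleAl (k : R[i]) (S T : A) :
  k *: nest_mul S T = nest_mul (k *: S) T.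
Proof. exact: nest_op_ext. Qed.

Lemma nest_scaleAr (k : R[i]) (S T : A) :
  k *: nest_mul S T = nest_mul S (k *: T).
Proof.
apply: nest_op_ext => x; apply/esym.
have S0 : S 0 = 0.
  by have := nest_op_linear S (-1) 0 0; rewrite scaler0 addr0 scaleN1r addNr.
by have := nest_op_linear S k (T x) 0; rewrite S0 !addr0.
Qed.

Definition nest_banach_algebra : unital_banach_algebra R[i] :=
  UnitalBanachAlgebra nest_mulA nest_mul1 nest_mulr1 nest_mulDl nest_mulDr
    nest_scaleAl nest_scaleAr nest_normM.

End nest_algebra_banach.

(* Takes the value +oo when infinitely many n k lie in the dyadic block;
   indices start at k = 1. *)
Definition dyadic_count {R : realType} (n : nat -> nat) (j : nat) : \bar R :=
  counting [set k | (1 <= k)%N /\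
                    (2 : R) ^ (j%:Z - 1) < (n k)%:R <= (2 : R) ^ j%:Z].

(* Main.v *)
Require Import Defs.
From HB Require Import structures.
From mathcomp Require Import all_boot all_order all_algebra.
From mathcomp Require Import all_classical all_reals all_analysis.
From mathcomp Require Import sesquilinear spectral.
From mathcomp Require Import complex.
From mathcomp Require Import zify.

Set Implicit Arguments.
Unset Strict Implicit.
Unset Printing Implicit Defensive.

Import Order.TTheory GRing.Theory Num.Theory Num.Def.
Import numFieldNormedType.Exports.
Local Open Scope classical_set_scope.
Local Open Scope complex_scope.
Local Open Scope ring_scope.

(** Fix an orthonormal basis adapted to the nest, and call a row of operators
    right unimodular when it has a right inverse with entries in the algebra.

    Lower bounds. Suppose that a row A shifts, isometrically, the coordinates
    beyond k_(j+1) of each of its n arguments into those beyond k_j, for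
    j < L. If A' is close to A and A' B = 1, apply B to a unit vector x far out
    and orthogonal to what A reaches: triangularity makes the part of B x beyond
    k_j decay geometrically in j, while its last part must produce x, so that
    |B| >= 2^L. A single row with such stretches for every L is therefore not
    a limit of right unimodular rows. For one operator, a shift moving one basis
    vector per atom will do. For n operators, a stretch of many consecutive atoms
    of comparable dimension leaves room for a partial isometry multiplying the
    distance to the end of the stretch by 4n, and then L is logarithmic in the
    number of atoms.

    Upper bound. If the dyadic counts are bounded, the dimensions grow
    geometrically, so for some q every atom dominates in dimension the span of
    all atoms more than q places before it. Perturb a row (A_1, A_2) only on its
    diagonal blocks. In the k-th block A_k + A_k -> A_k there is room to choose
    a right inverse G_k, of norm at most 1/eps, inside any prescribed subspace of
    codimension dim A_k. Prescribe that inverting A G, which is 1 plus a strictly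
    triangular operator, on the first k-1 atoms sends what G_k produces there
    into the last q of them. Then (A G)^(-1) is banded, hence bounded. *)

(** * Right inverses of perturbed matrices *)

Section matrices.
Local Open Scope sesquilinear_scope.
Context {C : numClosedFieldType}.

Lemma adjmxM m n p (A : 'M[C]_(m, n)) (B : 'M[C]_(n, p)) :
  (A *m B)^t* = B^t* *m A^t*.
Proof. by rewrite trmx_mul map_mxM. Qed.

Lemma dotmx_unitary m n (U : 'M[C]_(m, n)) (x y : 'rV_m) :
  U \is unitarymx -> dotmx (x *m U) (y *m U) = dotmx x y.
Proof. by move=> hU; rewrite !dotmxE adjmxM mulmxA mulmxtVK. Qed.

Lemma dotmx_mulr m n (A : 'M[C]_(m, n)) (x : 'rV_m) (y : 'rV_n) :
  dotmx (x *m A) y = dotmx x (y *m A^t*).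
Proof. by rewrite !dotmxE adjmxM trmxCK mulmxA. Qed.

(** [U] has orthonormal rows, so [y *m U^t* *m U] is the orthogonal projection of [y] onto their
    span. *)
Lemma dotmx_adj_unitary_le m n (U : 'M[C]_(m, n)) (y : 'rV_n) :
  U \is unitarymx -> dotmx (y *m U^t*) (y *m U^t*) <= dotmx y y.
Proof.
move=> hU; set w := y *m U^t*.
have h : dotmx (w *m U) (y - w *m U) = 0.
  by rewrite linearBr /= dotmx_unitary// dotmx_mulr subrr.
have -> : dotmx y y = dotmx w w + dotmx (y - w *m U) (y - w *m U).
  rewrite -(dotmx_unitary w w hU) -hnormDd//.
  by rewrite [w *m U + _]addrC subrK.
by rewrite lerDl dnorm_ge0.
Qed.

Lemma exists_unitary_rowspace m n k (A : 'M[C]_(m, n)) : \rank A = k ->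
  exists2 X : 'M[C]_(k, n), X \is unitarymx & (X <= A)%MS.
Proof.
move=> <-; exists (schmidt (row_base A)).
  by rewrite schmidt_unitarymx// rank_leq_col.
by rewrite eqmx_schmidt_free ?row_base_free// eq_row_base.
Qed.

(** The square matrix stacking [v] over [X] has its adjoint as a right inverse, hence as a two-sided
    one; the second product is the resolution of the identity. *)
Lemma exists_unitary_complement n (v : 'rV[C]_n.+1) : dotmx v v = 1 ->
  exists2 X : 'M[C]_(n, n.+1), X \is unitarymx &
    (v *m X^t* = 0) /\ v^t* *m v + X^t* *m X = 1%:M.
Proof.
move=> v1; have vu : v \is unitarymx.
  by apply/row_unitarymxP => i j; rewrite !row_id !ord1 v1.
have rv : (\rank (kermx (v^t*)) = n)%N.
  by rewrite mxrank_ker mxrank_map mxrank_tr mxrank_unitary// subn1.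
have [X Xu Xk] := exists_unitary_rowspace rv.
have Xv : X *m v^t* = 0 by apply/sub_kermxP.
have vX : v *m X^t* = 0 by rewrite -[v]trmxCK -adjmxM Xv trmx0 map_mx0.
exists X => //; split=> //.
have /unitarymxP hc : (col_mx v X : 'M[C]_(1 + n, n.+1)) \is unitarymx.
  apply/unitarymxP; rewrite tr_col_mx map_row_mx mul_col_row.
  by rewrite (unitarymxP vu) (unitarymxP Xu) vX Xv -scalar_mx_block.
by have := mulmx1C hc; rewrite tr_col_mx map_row_mx mul_row_col.
Qed.

Lemma exists_unit_kernel r n (A : 'M[C]_(r, n)) : (\rank A < r)%N ->
  exists2 w : 'rV_r, dotmx w w = 1 & w *m A = 0.
Proof.
move=> rA; have : kermx A != 0 by rewrite -mxrank_eq0 mxrank_ker subn_eq0 -ltnNge.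
case/rowV0Pn => w /sub_kermxP wA w0.
have w00 := dnorm_gt0 (@dotmx C r) w; rewrite w0 in w00.
exists ((sqrtC (dotmx w w))^-1 *: w); last by rewrite -scalemxAl wA scaler0.
rewrite dnormZ normfV ger0_norm ?sqrtC_ge0 ?ltW// exprVn sqrtCK mulVf//.
by rewrite gt_eqF.
Qed.

(* A singular pair: v spans an eigenline of M^* M, and a zero singular value is
   realised on the kernel of M, which is nonzero for lack of room. *)
Lemma exists_singular_pair r n (M : 'M[C]_(r, n.+1)) : (n < r)%N ->
  exists v : 'rV_n.+1, exists w : 'rV_r, exists2 s : C, 0 <= s &
    [/\ dotmx v v = 1, dotmx w w = 1, w *m M = s *: v & v *m M^t* = s *: w].
Proof.
move=> nr; have [l /eigenvalueP[v0 vl v00]] := eigenvalue_closed (M^t* *m M) (ltn0Sn n).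
have v0g := dnorm_gt0 (@dotmx C n.+1) v0; rewrite v00 in v0g.
pose v := (sqrtC (dotmx v0 v0))^-1 *: v0.
have v1 : dotmx v v = 1.
  rewrite dnormZ normfV ger0_norm ?sqrtC_ge0 ?ltW// exprVn sqrtCK mulVf//.
  by rewrite gt_eqF.
have {}vl : v *m M^t* *m M = l *: v.
  by rewrite -mulmxA -scalemxAl vl !scalerA mulrC.
have lE : l = dotmx (v *m M^t*) (v *m M^t*).
  by rewrite -[M^t* in RHS]trmxCK trmxCK -dotmx_mulr vl linearZl_LR /= v1 mulr1.
have l0 : 0 <= l by rewrite lE dnorm_ge0.
have [lz|lnz] := eqVneq l 0.
  have vM : v *m M^t* = 0 by apply/eqP; rewrite -(dnorm_eq0 (@dotmx C r)) /= -lE lz.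
  have Mv : M *m v^t* = 0 by rewrite -[M]trmxCK -adjmxM vM trmx0 map_mx0.
  have rM : (\rank M < r)%N.
    apply: leq_trans nr; rewrite ltnS.
    have := mulmx0_rank_max Mv; rewrite mxrank_map mxrank_tr.
    have -> : \rank v = 1%N.
      rewrite rank_rV; case: eqP v1 => // ->.
      by rewrite linear0l => /eqP; rewrite eq_sym oner_eq0.
    by rewrite addn1 ltnS.
  have [w w1 wM] := exists_unit_kernel rM.
  by exists v, w, 0 => //; split; rewrite ?scale0r.
have sl0 : sqrtC l != 0 by rewrite sqrtC_eq0.
exists v, ((sqrtC l)^-1 *: (v *m M^t*)), (sqrtC l); first by rewrite sqrtC_ge0.
split=> //.
- by rewrite dnormZ normfV ger0_norm ?sqrtC_ge0// exprVn sqrtCK /= -lE mulVf.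
- by rewrite -scalemxAl vl scalerA -[l in _ * l]sqrtCK expr2 mulrA mulVf// mul1r.
- by rewrite scalerA mulfV// scale1r.
Qed.

(** A partial polar decomposition, by induction on the number of columns: split off a singular pair
    [v], [w] and treat the compression of [M] to the orthogonal complements. *)
Lemma exists_polar n r (M : 'M[C]_(r, n)) : (n <= r)%N ->
  exists2 U : 'M[C]_(n, r), U \is unitarymx &
    forall x : 'rV_n, 0 <= dotmx (x *m (U *m M)) x.
Proof.
elim: n r M => [|n IH] r M nr.
  exists 0; first by apply/unitarymxP; apply/matrixP => -[].
  by move=> x; rewrite (thinmx0 x) mul0mx linear0l.
have [v [w [s s0 [v1 w1 wM vM]]]] := exists_singular_pair M nr.
case: r M nr w w1 wM vM => // r M nr w w1 wM vM.
have [X Xu [vX vX1]] := exists_unitary_complement v1.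
have [Y Yu [wY wY1]] := exists_unitary_complement w1.
have [U' U'u hU'] := IH r (Y *m M *m X^t*) nr.
(* Acting on rows, [U] sends [v] to [w] and maps the complement of [v] to that of [w] through
   [U']. *)
pose U := v^t* *m w + X^t* *m U' *m Y.
have Yw : Y *m w^t* = 0 by rewrite -[Y]trmxCK -adjmxM wY trmx0 map_mx0.
have ww : w *m w^t* = 1%:M.
  by rewrite [LHS]mx11_scalar -dotmxE w1.
exists U.
  apply/unitarymxP; rewrite /U raddfD map_mxD /= !adjmxM !trmxCK.
  rewrite mulmxDl !mulmxDr !mulmxA.
  rewrite -[_ *m w *m w^t*]mulmxA ww mulmx1.
  rewrite -[_ *m w *m Y^t*]mulmxA wY mulmx0 !mul0mx addr0.
  rewrite -[_ *m Y *m w^t*]mulmxA Yw mulmx0 !mul0mx add0r.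
  by rewrite -[_ *m Y *m Y^t*]mulmxA (unitarymxP Yu) mulmx1 -[_ *m U' *m U'^t*]mulmxA
    (unitarymxP U'u) mulmx1.
(* [M] maps the complement of [w] into that of [v], because [M *m v^t*] is a multiple of [w^t*]. *)
have YM : Y *m M = Y *m M *m X^t* *m X.
  rewrite -[LHS]mulmx1 -vX1 mulmxDr mulmxA -[Y *m M *m v^t*]mulmxA.
  have -> : M *m v^t* = s *: w^t*.
    by rewrite -[M]trmxCK -adjmxM vM linearZ /= map_mxZ /= geC0_conj.
  by rewrite -scalemxAr Yw scaler0 mul0mx add0r !mulmxA.
have UM : U *m M = s *: (v^t* *m v) + X^t* *m (U' *m (Y *m M *m X^t*)) *m X.
  rewrite mulmxDl -mulmxA wM -scalemxAr; congr (_ + _).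
  by rewrite -[LHS]mulmxA {1}YM !mulmxA.
move=> x; rewrite UM mulmxDr linearDl /= addr_ge0//.
  rewrite -scalemxAr linearZl_LR /= mulr_ge0// mulmxA dotmx_mulr.
  exact: dnorm_ge0.
by rewrite !mulmxA dotmx_mulr -!mulmxA mulmxA; have := hU' (x *m X^t*); rewrite !mulmxA.
Qed.

(** In the left kernel of [S], of dimension at least [n], choose orthonormal rows [U] with [U *m M]
    positive semidefinite. Adding [e *: U^t*] to [M] turns this product into [U *m M + e%:M], which
    is bounded below by [e]; its inverse times [U] is [G]. *)
Lemma perturb_right_inverse r n z (M : 'M[C]_(r, n)) (S : 'M[C]_(r, z)) (e : C) :
  0 < e -> (n + z <= r)%N ->
  exists G : 'M[C]_(n, r), exists D : 'M[C]_(r, n),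
    [/\ G *m (M + D) = 1%:M, G *m S = 0,
        forall x, dotmx (x *m G) (x *m G) <= e^-1 ^+ 2 * dotmx x x &
        forall y, dotmx (y *m D) (y *m D) <= e ^+ 2 * dotmx y y].
Proof.
move=> e0 nzr; pose k := \rank (kermx S).
have nk : (n <= k)%N.
  by rewrite /k mxrank_ker leq_subRL ?rank_leq_row// (leq_trans _ nzr)// addnC
    leq_add2l rank_leq_col.
have [K Ku Kk] := exists_unitary_rowspace (erefl k).
have KS : K *m S = 0 by apply/sub_kermxP.
have [U0 U0u hU0] := exists_polar (K *m M) nk.
pose U := U0 *m K.
have Uu : U \is unitarymx by rewrite mul_unitarymx.
have US : U *m S = 0 by rewrite -mulmxA KS mulmx0.
have hU x : 0 <= dotmx (x *m (U *m M)) x by rewrite -(mulmxA U0); exact: hU0.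
pose T := U *m M + e%:M.
(* The cross terms of the expansion are nonnegative since [U *m M] is positive semidefinite. *)
have hT x : e ^+ 2 * dotmx x x <= dotmx (x *m T) (x *m T).
  rewrite /T mulmxDr mul_mx_scalar dnormD dnormZ gtr0_norm//.
  rewrite addrAC lerDr addr_ge0 ?dnorm_ge0//.
  have hx : 0 <= dotmx (x *m (U *m M)) (e *: x).
    by rewrite linearZr_LR /= conj_Creal ?gtr0_real// mulr_ge0// ltW.
  by rewrite addr_ge0// conjC_ge0.
have Tunit : T \in unitmx.
  rewrite -row_free_unit -kermx_eq0; apply/rowV0P => x /sub_kermxP xT.
  have := hT x; rewrite xT linear0l pmulr_rle0 ?exprn_gt0// => h.
  by apply/eqP; rewrite -(dnorm_eq0 (@dotmx C n)) eq_le h dnorm_ge0.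
exists (invmx T *m U), (e *: U^t*); split.
- by rewrite -mulmxA mulmxDr -scalemxAr (unitarymxP Uu) scalemx1 mulVmx.
- by rewrite -mulmxA US mulmx0.
- move=> x; rewrite mulmxA dotmx_unitary//.
  have := hT (x *m invmx T); rewrite mulmxKV// => h.
  by rewrite exprVn ler_pdivlMl ?exprn_gt0.
- move=> y; rewrite -scalemxAr dnormZ /= gtr0_norm// ler_wpM2l ?exprn_ge0//.
    exact: ltW.
  exact: dotmx_adj_unitary_le.
Qed.

(** Diagonalise [G] unitarily and divide by the square roots of the eigenvalues. For the Gram matrix
    of a basis, the rows of [B] are then the coefficients of an orthonormal basis. *)
Lemma exists_whitening n (G : 'M[C]_n) : G^t* = G ->
    (forall c : 'rV_n, c != 0 -> 0 < (c *m G *m c^t*) 0 0) ->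
  exists B : 'M[C]_n, B *m G *m B^t* = 1%:M.
Proof.
move=> hG pG; set P := spectralmx G; set d := spectral_diag G.
have Pu : P \is unitarymx by exact: spectral_unitarymx.
have Gn : G \is normalmx by apply/normalmxP; rewrite hG.
have GE : G = invmx P *m diag_mx d *m P by apply/orthomx_spectralP.
have PGP : P *m G *m P^t* = diag_mx d.
  by rewrite [in LHS]GE invmx_unitary// !mulmxA (unitarymxP Pu) mul1mx mulmxtVK.
have d0 i : 0 < d 0 i.
  have r0 : row i P != 0.
    apply/eqP => r0; have /row_unitarymxP/(_ i i) := Pu.
    by rewrite r0 linear0l eqxx => /eqP; rewrite eq_sym oner_eq0.
  have := pG _ r0; rewrite -row_mul.
  have -> : (row i (P *m G) *m (row i P)^t*) 0 0 = (P *m G *m P^t*) i i.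
    by rewrite !mxE; apply: eq_bigr => j _; rewrite !mxE.
  by rewrite PGP mxE eqxx mulr1n.
pose t := \row_i (sqrtC (d 0 i))^-1.
have tt : diag_mx t *m diag_mx d *m (diag_mx t)^t* = 1%:M.
  rewrite tr_diag_mx map_diag_mx !mulmx_diag -diag_const_mx; congr diag_mx.
  apply/rowP => i; rewrite !mxE /= geC0_conj ?invr_ge0 ?sqrtC_ge0 ?ltW//.
  rewrite mulrAC -invfM -expr2 sqrtCK mulVf//.
  by rewrite gt_eqF.
exists (diag_mx t *m P).
by rewrite adjmxM -[in RHS]tt -PGP !mulmxA.
Qed.

End matrices.

(** * Bases adapted to the nest *)

Section orthonormal.
Context {R : realType} (H : completeNormedModType R[i])
  (dot : {dot H for conjC}) (hdot : hilbert_product dot).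
Local Notation C := R[i].

Lemma dotC (x y : H) : dot x y = conjC (dot y x).
Proof. by rewrite hermC expr0 mul1r. Qed.

Lemma dot_eq0C (x y : H) : dot x y = 0 -> dot y x = 0.
Proof. by rewrite dotC => /eqP; rewrite conjC_eq0 => /eqP. Qed.

Lemma sqr_normD (x y : H) : dot x y = 0 -> `|x + y| ^+ 2 = `|x| ^+ 2 + `|y| ^+ 2.
Proof. by move=> xy; rewrite !hdot hnormDd. Qed.

Lemma norm_le_sqr (x y : H) : (`|x| <= `|y|) = (`|x| ^+ 2 <= `|y| ^+ 2).
Proof. by rewrite ler_sqr ?nnegrE. Qed.

Lemma sqr_norm_sum (f : nat -> H) l m :
  (forall i j, i != j -> dot (f i) (f j) = 0) ->
  `|\sum_(l <= i < m) f i| ^+ 2 = \sum_(l <= i < m) `|f i| ^+ 2.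
Proof.
move=> fo; have [ml|lm] := leqP m l.
  by rewrite !big_geq// normr0 expr0n.
elim: m lm => // m IH; rewrite ltnS leq_eqVlt => /predU1P[->|lm].
  by rewrite !big_nat1.
rewrite !big_nat_recr ?(ltnW lm)//= -IH// sqr_normD// linear_sumlz big_nat big1//.
by move=> i /andP[_ im]; apply: fo; rewrite ltn_eqF.
Qed.

Context (e : nat -> H).

(** The orthogonal projection onto the span of the first [m] vectors, once these are orthonormal.
    The sequence is arbitrary because the adapted basis is shown orthonormal one atom at a time. *)
Definition proj (m : nat) (x : H) : H := \sum_(0 <= u < m) dot x (e u) *: e u.

Definition orthonormal_below (s : nat) : Prop :=
  forall u v, (u < s)%N -> (v < s)%N -> dot (e u) (e v) = (u == v)%:R.

Lemma proj_linear m : linear (proj m).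
Proof.
move=> a x y; rewrite /proj scaler_sumr -big_split /=; apply: eq_bigr => i _.
by rewrite linearPl /= scalerDl scalerA.
Qed.

Lemma projD m x y : proj m (x + y) = proj m x + proj m y.
Proof. by have := proj_linear m 1 x y; rewrite !scale1r. Qed.

Lemma proj0 m : proj m 0 = 0.
Proof. by rewrite /proj big1// => i _; rewrite linear0l scale0r. Qed.

Lemma projB m x y : proj m (x - y) = proj m x - proj m y.
Proof. by rewrite -scaleN1r addrC proj_linear scaleN1r addrC. Qed.

Lemma proj_sum m I (r : seq I) (F : I -> H) :
  proj m (\sum_(i <- r) F i) = \sum_(i <- r) proj m (F i).
Proof. by elim/big_rec2: _ => [|i y z _ <-]; rewrite ?proj0 ?projD. Qed.

Lemma dot_sum_coef s l m (c : nat -> C) v : orthonormal_below s ->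
  (v < s)%N -> (m <= s)%N ->
  dot (\sum_(l <= u < m) c u *: e u) (e v) = if (l <= v < m)%N then c v else 0.
Proof.
move=> eo vs ms; rewrite linear_sumlz /=.
transitivity (\sum_(l <= u < m | u == v) c u).
  rewrite [RHS]big_mkcond; apply: eq_big_nat => u /andP[_ um].
  rewrite linearZl_LR /= eo//; last exact: leq_trans um ms.
  by case: eqP; rewrite ?mulr1 ?mulr0.
by rewrite big_nat1_eq.
Qed.

Lemma dot_proj s m x v : orthonormal_below s -> (v < s)%N -> (m <= s)%N ->
  dot (proj m x) (e v) = if (v < m)%N then dot x (e v) else 0.
Proof. by move=> eo vs ms; rewrite (dot_sum_coef _ _ eo). Qed.

Lemma proj_proj s l m x : orthonormal_below s -> (l <= s)%N -> (m <= s)%N ->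
  proj l (proj m x) = proj (minn l m) x.
Proof.
move=> eo ls ms; rewrite {1}/proj /proj.
have [lm|ml] := leqP l m.
  apply: eq_big_nat => u /andP[_ ul].
  by rewrite (dot_proj _ eo) ?(leq_trans ul)// (leq_trans ul lm).
rewrite (big_cat_nat (leq0n m) (ltnW ml)) /= [X in _ + X]big_nat_cond [X in _ + X]big1 ?addr0.
  apply: eq_big_nat => u /andP[_ um].
  by rewrite (dot_proj _ eo) ?um// (leq_trans um ms).
move=> u /andP[/andP[mu ul] _].
by rewrite (dot_proj _ eo (leq_trans ul ls) ms) ltnNge mu scale0r.
Qed.

End orthonormal.

Section atom_basis.
Context {R : realType} (H : completeNormedModType R[i])
  (dot : {dot H for conjC}) (hdot : hilbert_product dot).
Local Notation C := R[i].
Local Open Scope sesquilinear_scope.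

(** The Gram matrix of a basis is positive definite because the basis is free, so it can be
    whitened. *)
Lemma has_dim_orthonormal (E : set H) n : has_dim E n ->
  exists2 f : nat -> H, orthonormal_below dot f n &
    forall x, E x <-> proj dot f n x = x.
Proof.
move=> [g [gfree gE]].
pose V (c : 'rV[C]_n) : H := \sum_i c 0 i *: g i.
have Vlin : linear V.
  move=> a x y; rewrite /V scaler_sumr -big_split /=; apply: eq_bigr => i _.
  by rewrite !mxE scalerDl scalerA.
have V0 : V 0 = 0 by rewrite /V big1// => i _; rewrite mxE scale0r.
have VE (m : nat) (c : 'rV[C]_m) (B : 'M[C]_(m, n)) : V (c *m B) = \sum_i c 0 i *: V (row i B).
  rewrite mulmx_sum_row; elim/big_rec2: _ => [//|i x y _ <-].
  by rewrite Vlin.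
pose G := \matrix_(i, j) dot (g i) (g j).
have dotV a b : dot (V a) (V b) = (a *m G *m b^t*) 0 0.
  rewrite linear_sumr !mxE; apply: eq_bigr => j _.
  rewrite linearZr_LR /= linear_sumlz !mxE mulrC; congr (_ * _).
  by apply: eq_bigr => i _; rewrite linearZl_LR mxE.
have hG : G^t* = G by apply/matrixP => i j; rewrite !mxE -dotC.
have pG (c : 'rV_n) : c != 0 -> 0 < (c *m G *m c^t*) 0 0.
  move=> c0; rewrite -dotV; apply: neq0_dnorm_gt0; apply: contra c0 => /eqP Vc.
  by apply/eqP/rowP => i; rewrite mxE; exact: gfree Vc i.
have [B BG] := exists_whitening hG pG.
have Bu : B \in unitmx by have /mulmx1_unit[] : B *m (G *m B^t*) = 1%:M by rewrite mulmxA.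
pose f (k : nat) : H := if insub k is Some i then V (row i B) else 0.
have fE (i : 'I_n) : f i = V (row i B).
  by rewrite /f insubT //= => ?; congr (V (row _ _)); exact: val_inj.
have fo : orthonormal_below dot f n.
  move=> u v un vn; have := fE (Ordinal un); have := fE (Ordinal vn) => /= -> ->.
  rewrite dotV -row_mul.
  have -> (i j : 'I_n) : (row i (B *m G) *m (row j B)^t*) 0 0 = (B *m G *m B^t*) i j.
    by rewrite !mxE; apply: eq_bigr => k _; rewrite !mxE.
  by rewrite BG mxE.
exists f => // x; rewrite gE; split.
  move=> [c _ <-]; pose b := (\row_i c i) *m invmx B.
  have -> : \sum_i c i *: g i =
      \sum_(0 <= k < n) (if insub k is Some i then b 0 i else 0) *: f k.
    transitivity (V (\row_i c i)); first by apply: eq_bigr => i _; rewrite mxE.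
    rewrite -[X in V X](mulmxKV Bu) VE big_mkord; apply: eq_bigr => i _.
    rewrite fE insubT //= => h; congr (b _ _ *: _); exact: val_inj.
  rewrite {1}/proj; apply: eq_big_nat => k /andP[_ kn]; congr (_ *: _).
  by rewrite (dot_sum_coef _ _ fo) ?kn.
rewrite /proj big_mkord => <-.
exists (fun j => (\row_i dot x (f i) *m B) 0 j) => //.
rewrite -[LHS]/(V _) VE; apply: eq_bigr => i _.
by rewrite mxE fE.
Qed.

Lemma linear_subspace_sum (E : set H) I (r : seq I) (c : I -> C) (F : I -> H) :
  linear_subspace E -> (forall i, E (F i)) -> E (\sum_(i <- r) c i *: F i).
Proof.
move=> [E0 EP] EF; elim: r => [|i r IH]; first by rewrite big_nil.
by rewrite big_cons; exact: EP.
Qed.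

Lemma nest_mono (N : omega_nest H) j k x : (j <= k)%N -> N j x -> N k x.
Proof.
elim: k => [|k IH]; first by rewrite leqn0 => /eqP ->.
rewrite leq_eqVlt => /predU1P[->//|jk] Njx.
by have [+ _] := @nest_lt _ _ N k; apply; exact: IH.
Qed.

(** Orthonormal bases of the atoms are concatenated; [s k] is the dimension of [N k]. *)
Lemma exists_nest_basis (N : omega_nest H) (n : nat -> nat) :
    (forall k, (1 <= k)%N -> has_dim (atom dot N k) (n k)) ->
  exists e : nat -> H, exists s : nat -> nat,
    [/\ forall u v, dot (e u) (e v) = (u == v)%:R,
        s 0%N = 0%N,
        forall k, s k.+1 = (s k + n k.+1)%N,
        forall k, (0 < n k.+1)%N &
        forall k x, N k x <-> proj dot e (s k) x = x].
Proof.
move=> hn.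
have /choice[f hf] : forall k, exists f : nat -> H, orthonormal_below dot f (n k.+1) /\
    forall x, atom dot N k.+1 x <-> proj dot f (n k.+1) x = x.
  by move=> k; have [f] := has_dim_orthonormal (hn k.+1 isT); exists f.
pose s k := (\sum_(0 <= j < k) n j.+1)%N.
have sS k : s k.+1 = (s k + n k.+1)%N by rewrite /s big_nat_recr.
have s_mono j k : (j <= k)%N -> (s j <= s k)%N.
  elim: k => [|k IH]; first by rewrite leqn0 => /eqP ->.
  by rewrite leq_eqVlt sS => /predU1P[->|/IH]; [rewrite sS|lia].
(* [e u] comes from the first atom that ends beyond [u]. The default 0 is never reached, as [s] is
   unbounded. *)
pose e u := if pselect (exists k, (u < s k.+1)%N) is left ex
  then f (ex_minn ex) (u - s (ex_minn ex))%N else 0.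
have eE k i : (i < n k.+1)%N -> e (s k + i)%N = f k i.
  move=> ik; rewrite /e; case: pselect => [ex|[]]; last by exists k; rewrite sS ltn_add2l.
  case: ex_minnP => j hj jmin.
  have jk : (j <= k)%N by apply: jmin; rewrite sS ltn_add2l.
  have kj : (k <= j)%N.
    rewrite leqNgt; apply/negP => lt_jk; have := s_mono _ _ lt_jk; lia.
  have -> : j = k by apply/eqP; rewrite eqn_leq jk.
  by rewrite addKn.
have fat k i : (i < n k.+1)%N -> atom dot N k.+1 (f k i).
  move=> ik; have [fo fE] := hf k; apply/fE.
  rewrite /proj (bigD1_seq i) ?mem_index_iota ?iota_uniq//= fo// eqxx scale1r.
  rewrite big_nat_cond big1 ?addr0// => j /andP[/andP[_ jn] ji].
  by rewrite fo// eq_sym (negPf ji) scale0r.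
(* Both facts go through one induction: orthogonality of the next atom to the earlier vectors uses
   that these lie in [N k]. *)
have claim k : orthonormal_below dot e (s k) /\
    forall x, N k x <-> proj dot e (s k) x = x.
  elim: k => [|k [eo eN]].
    rewrite /s big_nil; split=> // x; rewrite /proj big_nil nest_0.
    by split => /= ->.
  have Ne u : (u < s k)%N -> N k (e u).
    move=> us; apply/eN; rewrite /proj (bigD1_seq u) ?mem_index_iota ?iota_uniq//=.
    rewrite eo// eqxx scale1r big_nat_cond big1 ?addr0// => j /andP[/andP[_ jn] ji].
    by rewrite eo// eq_sym (negPf ji) scale0r.
  have [fo fE] := hf k.
  have projS x : proj dot e (s k.+1) x = proj dot e (s k) x + proj dot (f k) (n k.+1) x.
    rewrite /proj sS (big_cat_nat (leq0n (s k)) (leq_addr _ _)) /=; congr (_ + _).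
    rewrite -{1}[s k]add0n big_addn addKn.
    by apply: eq_big_nat => i /andP[_ ik]; rewrite addnC eE.
  have dot_fN i z : (i < n k.+1)%N -> N k z -> dot (f k i) z = 0.
    by move=> ik Nz; have [_] := fat _ _ ik; apply.
  have projN x : N k (proj dot e (s k) x).
    by apply/eN; rewrite (@proj_proj _ _ dot e (s k)) ?minnn.
  split.
    move=> u v us vs.
    have split_lt w : (w < s k.+1)%N ->
        (w < s k)%N \/ exists2 i, (i < n k.+1)%N & w = (s k + i)%N.
      move=> ws; have [|sw] := ltnP w (s k); first by left.
      by right; exists (w - s k)%N; move: ws; rewrite sS; lia.
    have [us'|[i ik ->]] := split_lt _ us; have [vs'|[j jk ->]] := split_lt _ vs.
    - exact: eo.
    - rewrite eE// dot_eq0C ?dot_fN//; last exact: Ne.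
      by rewrite ltn_eqF// ltn_addr.
    - rewrite eE// dot_fN//; last exact: Ne.
      by rewrite gtn_eqF// ltn_addr.
    - by rewrite !eE// fo// eqn_add2l.
  move=> x; split=> [Nx|<-]; last first.
    rewrite projS; have [_ NP] := nest_linear N k.+1.
    rewrite -[proj dot e _ _]scale1r; apply: NP.
      exact: nest_mono (projN x).
    rewrite /proj big_mkord; apply: linear_subspace_sum; first exact: nest_linear.
    by move=> i; case: (fat k i (ltn_ord i)).
  (* The component of [x] orthogonal to [N k] lies in the next atom, whose basis is [f k]. *)
  pose y := x - proj dot e (s k) x.
  have Ny : N k.+1 y.
    have [_ NP] := nest_linear N k.+1; rewrite /y addrC -scaleN1r; apply: NP => //.
    exact: nest_mono (projN x).
  have ay : atom dot N k.+1 y.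
    split=> // z /eN <-; rewrite linear_sumr big_nat big1// => u /andP[_ us].
    by rewrite linearZr_LR /= /y linearBl /= (@dot_proj _ _ dot e (s k))// us subrr mulr0.
  rewrite projS -[in RHS](subrK (proj dot e (s k) x) x) addrC; congr (_ + _).
  rewrite -/y; have /fE yE := ay; rewrite -[RHS]yE /proj; apply: eq_big_nat => i /andP[_ ik].
  congr (_ *: _); by rewrite /y linearBl /= (dot_eq0C (dot_fN _ _ ik (projN x))) subr0.
(* An atom of dimension 0 would make two consecutive subspaces equal. *)
have n0 k : (0 < n k.+1)%N.
  rewrite lt0n; apply/eqP => nk.
  have [_] := @nest_lt _ _ N k; apply => x; rewrite (claim k).2 (claim k.+1).2.
  by rewrite sS nk addn0.
have us u : (u <= s u)%N by elim: u => // u IH; rewrite sS; have := n0 u; lia.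
exists e, s; split=> //; first 2 last.
- by move=> k x; exact: (claim k).2.
- move=> u v; apply: (claim (maxn u v).+1).1; rewrite (leq_trans _ (us _))// ltnS.
    exact: leq_maxl.
  exact: leq_maxr.
- by rewrite /s big_nil.
Qed.

End atom_basis.

(** * Orthogonal sums of operators and the decay obstruction *)

Section nest_coordinates.
Context {R : realType} (H : completeNormedModType R[i])
  (dot : {dot H for conjC}) (hdot : hilbert_product dot).
Local Notation C := R[i].
Context (e : nat -> H) (eo : forall u v, dot (e u) (e v) = (u == v)%:R).
Local Notation P := (proj dot e).

Lemma dot_proj_e m x v : dot (P m x) (e v) = if (v < m)%N then dot x (e v) else 0.
Proof.
apply: (@dot_proj _ _ _ _ (maxn m v.+1)) => [u w _ _//||]; last exact: leq_maxl.
exact: leq_maxr.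
Qed.

Lemma projM l m x : P l (P m x) = P (minn l m) x.
Proof.
apply: (@proj_proj _ _ _ _ (maxn l m)) => [u w _ _//||]; first exact: leq_maxl.
exact: leq_maxr.
Qed.

Lemma proj_e m u : P m (e u) = if (u < m)%N then e u else 0.
Proof.
rewrite /proj; transitivity (\sum_(0 <= v < m | v == u) e v).
  rewrite [RHS]big_mkcond; apply: eq_bigr => v _; rewrite eo eq_sym.
  by case: eqP; rewrite ?scale1r ?scale0r.
by rewrite big_nat1_eq.
Qed.

Lemma dot_projl m x y : dot (P m x) y = dot x (P m y).
Proof.
rewrite /proj linear_sumlz linear_sumr; apply: eq_bigr => u _.
by rewrite linearZl_LR linearZr_LR /= -dotC mulrC.
Qed.

Lemma dot_projC m x y : dot (x - P m x) (P m y) = 0.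
Proof. by rewrite -dot_projl projB projM minnn subrr linear0l. Qed.

Lemma sqr_norm_proj m x : `|x| ^+ 2 = `|P m x| ^+ 2 + `|x - P m x| ^+ 2.
Proof.
rewrite addrC -(sqr_normD hdot); first by rewrite subrK.
exact: dot_projC.
Qed.

Lemma proj_le m x : `|P m x| <= `|x|.
Proof. by rewrite norm_le_sqr (sqr_norm_proj m x) lerDl exprn_ge0. Qed.

Lemma projC_le m x : `|x - P m x| <= `|x|.
Proof. by rewrite norm_le_sqr (sqr_norm_proj m x) lerDr exprn_ge0. Qed.

Lemma proj_id l m x : (l <= m)%N -> P l x = x -> P m x = x.
Proof. by move=> lm <-; rewrite projM (minn_idPr lm). Qed.

Lemma projC_anti l m x : (l <= m)%N -> `|x - P m x| <= `|x - P l x|.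
Proof.
move=> lm; have -> : x - P m x = (x - P l x) - P m (x - P l x).
  by rewrite projB projM (minn_idPr lm) opprB addrA subrK.
exact: projC_le.
Qed.

Context (N : omega_nest H) (s : nat -> nat)
  (NE : forall k x, N k x <-> P (s k) x = x).

Lemma proj_in k x : N k (P (s k) x).
Proof. by apply/NE; rewrite projM minnn. Qed.

Lemma proj_approx x (eps : C) : 0 < eps -> exists k, `|x - P (s k) x| < eps.
Proof.
move=> eps0; have [z []] : ball x eps `&` \bigcup_k N k !=set0.
  apply: (nest_dense N); first by exists x; exact: ballxx.
  exact: ball_open.
rewrite -ball_normE /ball_ /= => xz [k _ /NE zk]; exists k.
rewrite (le_lt_trans _ xz)//.
have -> : x - P (s k) x = (x - z) - P (s k) (x - z).
  by rewrite projB zk opprB addrA subrK.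
exact: projC_le.
Qed.

(** The grouping [t] is left free: [id] gives single coordinates and [s] gives the atoms. *)
Definition block (t : nat -> nat) (k : nat) (x : H) : H := P (t k.+1) x - P (t k) x.

Lemma dot_block (t : nat -> nat) j k x y : {homo t : i j / (i <= j)%N} ->
  j != k -> dot (block t j x) (block t k y) = 0.
Proof.
move=> tmono; have hlt i l z w : (i < l)%N -> dot (block t i z) (block t l w) = 0.
  move=> il; have h a b : (a <= t l)%N -> dot (P a b) (block t l w) = 0.
    move=> al; rewrite dot_projl /block projB !projM.
    by rewrite !(minn_idPl _) ?subrr ?linear0r// (leq_trans al)// tmono.
  by rewrite {1}/block linearBl /= !h ?subrr// ?tmono// ltnW.
have [jk _|kj _|-> /eqP//] := ltngtP j k; first exact: hlt.
by apply: dot_eq0C; exact: hlt.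
Qed.

Lemma sum_block (t : nat -> nat) l m x : (l <= m)%N ->
  \sum_(l <= k < m) block t k x = P (t m) x - P (t l) x.
Proof. by move=> lm; rewrite telescope_sumr. Qed.

(** Each [T k] sees only the [k]-th block and the images are mutually orthogonal, so by Pythagoras
    the common bound [M] passes to the sum. Partial sums converge pointwise, and are finite sums on
    vectors supported on finitely many blocks. *)
Lemma exists_orthogonal_sum (t : nat -> nat) (T : nat -> H -> H) (M : C) :
    0 <= M -> (forall k, (k <= t k)%N) -> {homo t : i j / (i <= j)%N} -> t 0%N = 0%N ->
    (forall k, linear (T k)) ->
    (forall j k x y, j != k -> dot (T j x) (T k y) = 0) ->
    (forall k x, `|T k x| <= M * `|block t k x|) ->
    (forall j k x, N k x -> N k (T j x)) ->
  exists2 S : nest_algebra N, `|S| <= M &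
    forall K x, P (t K) x = x -> S x = \sum_(0 <= k < K) T k x.
Proof.
move=> M0 tge tmono t0 Tlin To Tb TN.
pose S K x := \sum_(0 <= k < K) T k x.
(* Increments of the partial sums are at most [M] times those of the projections, so they form a
   Cauchy sequence. *)
have Sdiff L K x : (L <= K)%N -> `|S K x - S L x| <= M * `|P (t K) x - P (t L) x|.
  move=> LK; have -> : S K x - S L x = \sum_(L <= k < K) T k x.
    by rewrite /S (big_cat_nat (leq0n L) LK) /= [X in X - _]addrC addrK.
  rewrite -ler_sqr ?nnegrE ?mulr_ge0//.
  rewrite (sqr_norm_sum hdot); last by move=> i j; exact: To.
  rewrite exprMn -sum_block// (sqr_norm_sum hdot); last first.
    by move=> i j; exact: dot_block.
  rewrite mulr_sumr ler_sum// => k _; rewrite -exprMn ler_sqr ?nnegrE ?mulr_ge0//.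
have Slin K : linear (S K).
  move=> a x y; rewrite /S scaler_sumr -big_split /=; apply: eq_bigr => k _.
  exact: Tlin.
have Scauchy x : cauchy (S ^~ x @ \oo).
  apply: cauchy_exP => eps eps0.
  have M1 : 0 < M + 1 by rewrite ltr_wpDl.
  have [k hk] := proj_approx x (divr_gt0 eps0 M1).
  exists (S (s k) x); exists (s k) => // K /= kK.
  rewrite -ball_normE /ball_ /= distrC (le_lt_trans (Sdiff _ _ _ kK))//.
  rewrite (@le_lt_trans _ _ ((M + 1) * `|x - P (s k) x|))//; last first.
    by rewrite mulrC -ltr_pdivlMr.
  rewrite ler_pM// ?lerDl//.
  have -> : P (t K) x - P (t (s k)) x = P (t K) (x - P (t (s k)) x).
    by rewrite projB projM (minn_idPr _)// tmono.
  by rewrite (le_trans (proj_le _ _))// projC_anti.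
pose g x := lim (S ^~ x @ \oo).
have gE x : S ^~ x @ \oo --> g x by apply: cauchy_cvg.
have gfin K x : P (t K) x = x -> g x = S K x.
  move=> xK; apply: (norm_cvg_unique (gE x)).
  apply: cvg_near_cst; exists K => // L /= KL; apply/eqP; rewrite -subr_eq0 -normr_le0.
  rewrite (le_trans (Sdiff _ _ _ KL))// xK.
  by rewrite (proj_id (tmono _ _ KL) xK) subrr normr0 mulr0.
have glin : linear g.
  move=> a x y; have h := cvgD (cvgZl_tmp (k := a) (gE x)) (gE y).
  have E : S ^~ (a *: x + y) = (a \*: S ^~ x) + S ^~ y.
    by apply/funext => K; exact: Slin.
  have := gE (a *: x + y); rewrite E => h'.
  exact: norm_cvg_unique h' (h _ _).
have gb x : `|g x| <= M * `|x|.
  apply/ler_addgt0Pr => d d0.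
  have /cvgrPdist_lt/(_ _ d0) [K _ /(_ K (leqnn K)) /= hK] := gE x.
  rewrite -[g x](subrK (S K x)) (le_trans (ler_normD _ _))// addrC lerD//; last exact: ltW.
  have := Sdiff 0%N K x (leq0n K).
  have -> : S 0%N x = 0 by rewrite /S big_geq.
  have -> : P (t 0%N) x = 0 by rewrite t0 /proj big_geq.
  rewrite !subr0 => h.
  by rewrite (le_trans h)// ler_wpM2l// proj_le.
have gin : g \in in_nest_algebra N.
  apply/in_nest_algebraP; split; last first.
    move=> k x Nx; rewrite (gfin (s k)); last first.
      by move/NE: Nx; apply: proj_id; exact: tge.
    rewrite /S; elim/big_rec: _ => [|j y _ Ny]; first by case: (nest_linear N k).
    rewrite -[T j x]scale1r; apply: (nest_linear N k).2 => //; exact: TN.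
  split=> //; exists (complex.Re M); exact: op_boundsP.
exists (NestOp gin); last exact: gfin.
by rewrite nest_normE; exact: opnorm_leC.
Qed.

Lemma nest_op0 (T : nest_algebra N) : T 0 = 0.
Proof. by have := nest_op_linear T (-1) 0 0; rewrite scaler0 addr0 scaleN1r addNr. Qed.

Lemma nest_op_add (T : nest_algebra N) x y : T (x + y) = T x + T y.
Proof. by have := nest_op_linear T 1 x y; rewrite !scale1r. Qed.

Lemma nest_op_scale (T : nest_algebra N) a x : T (a *: x) = a *: T x.
Proof. by have := nest_op_linear T a x 0; rewrite nest_op0 !addr0. Qed.

Lemma nest_op_sub (T : nest_algebra N) x y : T (x - y) = T x - T y.
Proof. by rewrite nest_op_add -scaleN1r nest_op_scale scaleN1r. Qed.

Lemma nest_op_sum (T : nest_algebra N) I (r : seq I) (p : pred I) (F : I -> H) :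
  T (\sum_(i <- r | p i) F i) = \sum_(i <- r | p i) T (F i).
Proof. by elim/big_rec2: _ => [|i y z _ <-]; rewrite ?nest_op0 ?nest_op_add. Qed.

Lemma nest_sumE I (r : seq I) (F : I -> nest_algebra N) x :
  (\sum_(i <- r) F i) x = \sum_(i <- r) F i x.
Proof. by elim/big_rec2: _ => [//|i y z _ <-]. Qed.

Lemma eq_nest_op (S T : nest_algebra N) :
  (forall k x, N k x -> S x = T x) -> S = T.
Proof.
move=> ST; apply/eqP; rewrite -subr_eq0; apply/eqP/nest_op_ext => x.
apply/eqP; rewrite -normr_le0; apply/ler_addgt0Pr => d d0; rewrite add0r.
have D1 : 0 < `|S - T| + 1 by rewrite ltr_wpDl.
have [k hk] := proj_approx x (divr_gt0 d0 D1).
have STk : (S - T : nest_algebra N) (P (s k) x) = 0.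
  by rewrite nest_opD nest_opN (ST k) ?subrr//; exact: proj_in.
have -> : (S - T : nest_algebra N) x = (S - T : nest_algebra N) (x - P (s k) x).
  by rewrite (nest_op_sub (S - T)) STk subr0.
rewrite (le_trans (nest_op_le _ _))//.
rewrite (@le_trans _ _ ((`|S - T| + 1) * `|x - P (s k) x|))// ?ler_wpM2r ?lerDl//.
by rewrite mulrC -ler_pdivlMr// ltW.
Qed.

Lemma complex_archi (c : C) : 0 <= c -> exists L, c < 2 ^+ L.
Proof.
move=> c0; exists (Num.bound (complex.Re c)); rewrite -(ge0_Re c0).
have -> : (2 ^+ Num.bound (complex.Re c) : C) = (2 ^+ Num.bound (complex.Re c))%:C.
  by rewrite rmorphXn /= rmorph_nat.
rewrite ltcR (lt_le_trans (archi_boundP (Re_ge0 c0)))//.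
by rewrite -natrX ler_nat ltnW// ltn_expl.
Qed.

(* The components [t j] of a right inverse beyond [k j] decay geometrically,
   because the row differs little from one that shifts them onto each other. *)
Lemma not_dense_of_shift (n : nat) (a : 'rV[nest_banach_algebra N]_n.+1) :
    (forall L, exists k : nat -> nat, exists x,
      [/\ N (k L) x, x != 0, forall j, (j < L)%N -> P (s (k j)) x = 0,
          forall i y, N (k L) y -> dot ((a ord0 i : nest_algebra N) y) x = 0 &
          forall j (y : 'I_n.+1 -> H) i, (j < L)%N -> (forall i, N (k L) (y i)) ->
            let z := \sum_i (a ord0 i : nest_algebra N) (y i) in
            `|y i - P (s (k j.+1)) (y i)| <= `|z - P (s (k j)) z|]) ->
  ~ dense (@right_unimodular R (nest_banach_algebra N) n.+1).
Proof.
(* Each of the [n.+1] tails will be at most [eps] times the previous sum of tails; this [eps] makes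
   the sum halve at every step. *)
move=> hL hd; pose eps : C := (2 * n.+1%:R)^-1.
have n0 : 0 < n.+1%:R :> C by rewrite ltr0n.
have eps0 : 0 < eps by rewrite invr_gt0 mulr_gt0.
have eps1 : eps <= 1.
  rewrite invf_le1 ?mulr_gt0// -natrM ler1n; lia.
have [a' [aa' [b ab]]] :
    ball a eps `&` @right_unimodular R (nest_banach_algebra N) n.+1 !=set0.
  have [||c [/interior_subset]] := hd (ball a eps)^°; last by exists c.
    by exists a; exact: nbhsx_ballx.
  exact: open_interior.
pose A i : nest_algebra N := a ord0 i.
pose A' i : nest_algebra N := a' ord0 i.
pose B i : nest_algebra N := b ord0 i.
have hAA' i : `|A' i - A i| <= eps.
  by have := aa'.2 ord0 i; rewrite -ball_normE /ball_ /= distrC => /ltW.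
have AB x : \sum_i A' i (B i x) = x.
  by have /(congr1 (fun T : nest_algebra N => T x)) := ab; rewrite nest_sumE.
pose beta := \sum_i `|B i|.
have [L Lb] : exists L, beta < 2 ^+ L by apply: complex_archi; rewrite sumr_ge0.
(* Length [L.+1] makes the estimate on [x] available at index [L] as well. *)
have [k [x [Nx x0 xj xA hA]]] := hL L.+1.
pose y i := B i x; pose t j := \sum_i `|y i - P (s (k j)) (y i)|.
have Ny i : N (k L.+1) (y i) by exact: nest_op_invariant.
pose z := \sum_i A i (y i).
(* [x] is the sum of [w], the part of [z] beyond [k j], and of the part beyond [k j] of [v], which
   is the perturbation applied to the tails of the [y i]. Since [w] is orthogonal to [x], the latter
   part is at least as long as [x] and as [w]; it is at most [eps * t j]. *)
have step j : (j < L.+1)%N -> `|x| <= eps * t j /\ `|z - P (s (k j)) z| <= eps * t j.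
  move=> jL; pose w := z - P (s (k j)) z.
  pose v := \sum_i (A' i - A i : nest_algebra N) (y i - P (s (k j)) (y i)).
  have xwv : x = w + (v - P (s (k j)) v).
    have -> : v - P (s (k j)) v = (x - z) - P (s (k j)) (x - z).
      have -> : x - z = v + \sum_i (A' i - A i : nest_algebra N) (P (s (k j)) (y i)).
        rewrite -big_split /= -{1}(AB x) -sumrB; apply: eq_bigr => i _.
        by rewrite -(nest_op_add (A' i - A i)) subrK.
      set r := \sum_i _; have : P (s (k j)) r = r.
        rewrite /r proj_sum; apply: eq_bigr => i _; apply/NE.
        by apply: nest_op_invariant; exact: proj_in.
      by rewrite projD => ->; rewrite opprD addrACA subrr addr0.
    rewrite /w projB xj// sub0r opprK; rewrite addrA -[z - _ + _]addrA.
    by rewrite [- _ + _]addrC [z + _]addrA subrK addrC subrK.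
  have wx : dot w x = 0.
    rewrite /w linearBl /= dot_projl xj// linear0r subr0 /z linear_sumlz big1// => i _.
    exact: xA.
  have vb : `|v - P (s (k j)) v| <= eps * t j.
    rewrite (le_trans (projC_le _ _))// (le_trans (ler_norm_sum _ _ _))//.
    rewrite /t mulr_sumr ler_sum// => i _.
    by rewrite (le_trans (nest_op_le _ _))// ler_wpM2r.
  have vE : `|v - P (s (k j)) v| ^+ 2 = `|x| ^+ 2 + `|w| ^+ 2.
    have -> : v - P (s (k j)) v = x + (- w) by rewrite xwv [w + _]addrC addrK.
    rewrite (sqr_normD hdot) ?normrN//.
    by rewrite linearNr /= dot_eq0C ?oppr0.
  by split; rewrite (le_trans _ vb)// norm_le_sqr vE ?lerDl ?lerDr exprn_ge0.
(* By the shift hypothesis each tail beyond [k j.+1] is at most the part of [z] beyond [k j]. *)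
have decay j : (j <= L)%N -> 2 ^+ j * t j <= t 0%N.
  elim: j => [_|j IH jL]; first by rewrite mul1r.
  apply: le_trans (IH (ltnW jL)); rewrite exprSr -mulrA ler_wpM2l ?exprn_ge0//.
  have [_ zj] := step j (ltnW jL).
  rewrite -ler_pdivlMl//; apply: (@le_trans _ _ (\sum_(i < n.+1) `|z - P (s (k j)) z|)).
    by apply: ler_sum => i _; apply: hA => //; exact: ltnW.
  rewrite sumr_const card_ord -[leLHS]mulr_natl -ler_pdivlMl// (le_trans zj)// mulrA.
  by rewrite /eps invfM [_^-1 * 2^-1]mulrC.
have [xL _] := step L (ltnSn L).
have t0b : t 0%N <= beta * `|x|.
  rewrite /t /beta mulr_suml ler_sum// => i _.
  by rewrite (le_trans (projC_le _ _))// nest_op_le.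
have xp : 0 < `|x| by rewrite normr_gt0.
(* The last sum of tails still dominates the norm of [x], so [2 ^+ L <= beta], against the choice of
   [L]. *)
have : 2 ^+ L * `|x| <= beta * `|x|.
  apply: le_trans t0b; apply: le_trans (decay L (leqnn L)).
  rewrite ler_wpM2l ?exprn_ge0// (le_trans xL)//.
  by rewrite ler_piMl// sumr_ge0.
by rewrite ler_pM2r// => /(lt_le_trans Lb); rewrite ltxx.
Qed.

End nest_coordinates.

(** * Operators permuting basis vectors *)

Section partial_injections.
Context {R : realType} (H : completeNormedModType R[i])
  (dot : {dot H for conjC}) (hdot : hilbert_product dot).
Local Notation C := R[i].
Context (e : nat -> H) (eo : forall u v, dot (e u) (e v) = (u == v)%:R).
Local Notation P := (proj dot e).
Context (N : omega_nest H) (s : nat -> nat)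
  (NE : forall k x, N k x <-> P (s k) x = x).

Lemma dot_nest_ge k x u : N k x -> (s k <= u)%N -> dot x (e u) = 0.
Proof. by move=> /NE <- su; rewrite (dot_proj_e eo) ltnNge su. Qed.

Lemma nest_e k u : (u < s k)%N -> N k (e u).
Proof. by move=> us; apply/NE; rewrite (proj_e eo) us. Qed.

Lemma bessel (g : nat -> nat) l m x :
    (forall u v, (l <= u < m)%N -> (l <= v < m)%N -> g u = g v -> u = v) ->
  \sum_(l <= u < m) `|dot x (e (g u))| ^+ 2 <= `|x| ^+ 2.
Proof.
(* [F] vanishes outside the range so that its terms are orthogonal for all pairs of indices; their
   sum [p] is the projection of [x] onto the span of the [e (g u)]. *)
move=> ginj; pose F u := if (l <= u < m)%N then dot x (e (g u)) *: e (g u) else 0.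
have Fo u v : u != v -> dot (F u) (F v) = 0.
  rewrite /F; case: ifPn => hu; last by rewrite linear0l.
  case: ifPn => hv; last by rewrite linear0r.
  move=> uv; rewrite linearZl_LR linearZr_LR /= eo.
  case: eqP => [/ginj|]; last by rewrite !mulr0.
  by move=> /(_ hu hv) uvE; rewrite uvE eqxx in uv.
have Fn u : `|F u| ^+ 2 = if (l <= u < m)%N then `|dot x (e (g u))| ^+ 2 else 0.
  rewrite /F; case: ifP => _; last by rewrite normr0 expr0n.
  by rewrite hdot dnormZ /= eo eqxx mulr1.
have Fx u : dot x (F u) = dot (F u) (F u).
  rewrite /F; case: ifP => _; last by rewrite !linear0r.
  by rewrite !linearZr_LR linearZl_LR /= eo eqxx mulr1 mulrC.
pose p := \sum_(l <= u < m) F u.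
have pp : dot x p = dot p p.
  rewrite /p linear_sumr linear_sumlz; apply: eq_big_nat => u lum.
  rewrite linear_sumr (bigD1_seq u) ?mem_index_iota ?iota_uniq//= Fx.
  by rewrite big1 ?addr0// => v vu; rewrite Fo// eq_sym.
have xp : dot p (x - p) = 0 by apply: dot_eq0C; rewrite linearBl /= pp subrr.
have -> : \sum_(l <= u < m) `|dot x (e (g u))| ^+ 2 = `|p| ^+ 2.
  by rewrite (sqr_norm_sum hdot)//; apply: eq_big_nat => u lum; rewrite Fn lum.
rewrite -[in leRHS](subrK p x) addrC (sqr_normD hdot) ?lerDl ?exprn_ge0//.
Qed.

(** [None] stands for a basis vector sent to 0. Injectivity makes the images of distinct coordinates
    orthogonal, so they sum to a contraction; the second hypothesis keeps each [N k] invariant. *)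
Lemma exists_partial_injection (f : nat -> option nat) :
    (forall u u' v, f u = Some v -> f u' = Some v -> u = u') ->
    (forall u v k, f u = Some v -> (u < s k)%N -> (v < s k)%N) ->
  exists T : nest_algebra N, forall u, T (e u) = oapp e 0 (f u).
Proof.
move=> finj flev; pose T u x := dot x (e u) *: oapp e 0 (f u).
have blockE u x : block dot e id u x = dot x (e u) *: e u.
  by rewrite /block /proj big_nat_recr //= [X in X - _]addrC addrK.
have [S _ SE] : exists2 S : nest_algebra N, `|S| <= 1 &
    forall K x, P K x = x -> S x = \sum_(0 <= k < K) T k x.
  apply: (@exists_orthogonal_sum _ _ dot hdot e eo N s NE id T 1) => //.
  - by move=> u a x y; rewrite /T linearPl scalerDl scalerA.
  - move=> u v x y uv; rewrite /T linearZl_LR linearZr_LR /=.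
    case fu : (f u) => [u'|]; last by rewrite linear0l !mulr0.
    case fv : (f v) => [v'|]; last by rewrite linear0r !mulr0.
    rewrite /= eo; case: eqP => [uv'|]; last by rewrite !mulr0.
    by move: uv; rewrite (finj u v v') ?eqxx// -uv'.
  - move=> u x; rewrite /T blockE mul1r !normrZ ler_wpM2l//.
    have e1 v : `|e v| = 1.
      by apply/eqP; rewrite -sqrp_eq1// hdot eo eqxx.
    by case: (f u) => [v|] /=; rewrite ?normr0 !e1.
  - move=> u k x Nx; rewrite /T; have [su|us] := leqP (s k) u.
      by rewrite (dot_nest_ge Nx su) scale0r; case: (nest_linear N k).
    have [N0 NP] := nest_linear N k; rewrite -[_ *: _]addr0; apply: NP => //.
    by case fu : (f u) => [v|] //=; apply: nest_e; exact: flev fu us.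
exists S => u; rewrite (SE u.+1); last by rewrite (proj_e eo) ltnSn.
rewrite big_nat_recr //= /T eo eqxx scale1r big_nat_cond big1 ?add0r//.
by move=> v /andP[/andP[_ vu] _]; rewrite eo gtn_eqF// scale0r.
Qed.

(** Reduces the obstruction to maps of indices, with [e v0] as the vector missed. Injectivity in the
    pair [(i, u)] makes the ranges orthogonal, so every coordinate of every argument can be read off
    the sum of the images. *)
Lemma not_dense_of_partial_injections n (f : 'I_n.+1 -> nat -> option nat) :
    (forall i i' u u' v, f i u = Some v -> f i' u' = Some v -> i = i' /\ u = u') ->
    (forall i u v k, f i u = Some v -> (u < s k)%N -> (v < s k)%N) ->
    (forall L, exists k : nat -> nat, exists v0,
      [/\ (v0 < s (k L))%N, forall j, (j < L)%N -> (s (k j) <= v0)%N,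
          forall i u, (u < s (k L))%N -> f i u <> Some v0 &
          forall j i u, (j < L)%N -> (s (k j.+1) <= u < s (k L))%N ->
            exists2 v, f i u = Some v & (s (k j) <= v)%N]) ->
  ~ dense (@right_unimodular R (nest_banach_algebra N) n.+1).
Proof.
move=> finj flev fL.
have /choice[T TE] i : exists T : nest_algebra N, forall u, T (e u) = oapp e 0 (f i u).
  apply: exists_partial_injection => [u u' v fu fu'|u v k]; last exact: flev.
  by have [] := finj _ _ _ _ _ fu fu'.
have TyE i k y : N k y -> T i y = \sum_(0 <= u < s k) dot y (e u) *: oapp e 0 (f i u).
  move=> /NE yE; rewrite -{1}yE /proj nest_op_sum; apply: eq_bigr => u _.
  by rewrite nest_op_scale TE.
have dotT i i' k y v u : N k y -> f i u = Some v ->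
    dot (T i' y) (e v) = if i' == i then dot y (e u) else 0.
  move=> Ny fu; rewrite (TyE _ _ _ Ny) linear_sumlz /=.
  have [->|ii'] := eqVneq i' i; last first.
    rewrite big1// => w _; rewrite linearZl_LR /=.
    case fw : (f i' w) => [v'|] /=; last first.
      by rewrite linear0l mulr0.
    rewrite eo; case: eqP => [vv'|]; last by rewrite mulr0.
    have [ii] := finj i' i w u v (eq_trans fw (congr1 Some vv')) fu.
    by rewrite ii eqxx in ii'.
  transitivity (\sum_(0 <= w < s k | w == u) dot y (e w)).
    rewrite [RHS]big_mkcond; apply: eq_bigr => w _; rewrite linearZl_LR /=.
    case: (eqVneq w u) => [->|wu]; first by rewrite fu /= eo eqxx mulr1.
    case fw : (f i w) => [v'|] /=; last by rewrite linear0l mulr0.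
    rewrite eo; case: eqP => [vv'|]; last by rewrite mulr0.
    have [_ uu] := finj i i w u v (eq_trans fw (congr1 Some vv')) fu.
    by rewrite uu eqxx in wu.
  rewrite big_nat1_eq /=; case: ltnP => // su.
  by rewrite (dot_nest_ge Ny su).
apply: (@not_dense_of_shift _ _ dot hdot e eo N s NE n (\row_i T i)) => L.
have [k [v0 [v0L v0j v0f hf]]] := fL L.
exists k, (e v0); split.
- exact: nest_e.
- apply/eqP => e0; have := eo v0 v0; rewrite e0 linear0l eqxx => /eqP.
  by rewrite eq_sym oner_eq0.
- by move=> j jL; rewrite (proj_e eo) ltnNge v0j.
- move=> i y Ny; rewrite mxE (TyE _ _ _ Ny) linear_sumlz big_nat big1// => u /andP[_ us].
  rewrite linearZl_LR /=; case fu : (f i u) => [v|] /=; last by rewrite linear0l mulr0.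
  rewrite eo; case: eqP => [vv0|]; last by rewrite mulr0.
  by case: (v0f i u us); rewrite fu vv0.
- move=> j y i jL Ny /=; set z := \sum_(_ < _) _.
  have zE : z = \sum_i' T i' (y i') by apply: eq_bigr => i' _; rewrite mxE.
  have dotz u v : f i u = Some v -> dot z (e v) = dot (y i) (e u).
    move=> fu; rewrite zE linear_sumlz (bigD1 i)//= (dotT i i _ _ v u (Ny i))// eqxx.
    by rewrite big1 ?addr0// => i' ii'; rewrite (dotT i i' _ _ v u (Ny i'))// (negPf ii').
  rewrite norm_le_sqr; set m := s (k j.+1); set M := s (k L).
  have -> : `|y i - P m (y i)| ^+ 2 = \sum_(m <= u < M) `|dot (y i) (e u)| ^+ 2.
    have [mM|Mm] := leqP m M; last first.
      rewrite big_geq ?(ltnW Mm)// (_ : _ - _ = 0) ?normr0 ?expr0n//.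
      by apply/eqP; rewrite subr_eq0 eq_sym; apply/eqP/(proj_id eo (ltnW Mm))/NE/Ny.
    have /NE yE := Ny i; rewrite -{1}yE /proj (big_cat_nat (leq0n m) mM) /=.
    rewrite addrC addrK (sqr_norm_sum hdot) => [|u v uv]; last first.
      by rewrite linearZl_LR linearZr_LR /= eo (negPf uv) !mulr0.
    by apply: eq_bigr => u _; rewrite hdot dnormZ /= eo eqxx mulr1.
  (* The default 0 does not occur for [u] between [m] and [M], where [f i u] has a value. *)
  pose g u := odflt 0%N (f i u).
  have gE u : (m <= u < M)%N -> f i u = Some (g u) /\ (s (k j) <= g u)%N.
    by move=> mu; have [v fu sv] := hf j i u jL mu; rewrite /g fu.
  apply: le_trans (@bessel g m M _ _); last first.
    move=> u v /gE[fu _] /gE[fv _] guv.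
    by have [] := finj i i u v (g u) fu; rewrite ?fv ?guv.
  rewrite le_eqVlt; apply/orP; left; apply/eqP; apply: eq_big_nat => u mu.
  have [fu su] := gE u mu; rewrite linearBl /= (dot_proj_e eo) ltnNge su subr0.
  by rewrite (dotz _ _ fu).
Qed.

End partial_injections.

(** * Perturbing the diagonal blocks *)

Section local_coordinates.
Local Open Scope sesquilinear_scope.
Context {R : realType} (H : completeNormedModType R[i])
  (dot : {dot H for conjC}) (hdot : hilbert_product dot).
Local Notation C := R[i].
Context (e : nat -> H) (eo : forall u v, dot (e u) (e v) = (u == v)%:R).
Local Notation P := (proj dot e).

Definition coord_vec (l m : nat) (x : 'rV[C]_m) : H := \sum_(i < m) x 0 i *: e (l + i)%N.
Definition coords (l m : nat) (z : H) : 'rV[C]_m := \row_i dot z (e (l + i)%N).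

Lemma coord_vec_linear l m : linear (@coord_vec l m).
Proof.
move=> a x y; rewrite /coord_vec scaler_sumr -big_split /=; apply: eq_bigr => i _.
by rewrite !mxE scalerDl scalerA.
Qed.

Lemma coords_linear l m : linear (coords l m).
Proof. by move=> a x y; apply/rowP => i; rewrite !mxE linearPl. Qed.

Lemma dot_coord_vec l m (x y : 'rV_m) : dot (coord_vec l x) (coord_vec l y) = dotmx x y.
Proof.
rewrite /coord_vec linear_sumlz dotmxE mxE; apply: eq_bigr => i _.
rewrite linearZl_LR linear_sumr (bigD1 i)//= linearZr_LR /= eo eqxx mulr1.
rewrite big1 ?addr0 ?mxE// => j ji; rewrite linearZr_LR /= eo eqn_add2l.
by rewrite (_ : (i == j :> nat) = false) ?mulr0//; apply/negbTE; rewrite eq_sym.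
Qed.

Lemma sqr_norm_coord_vec l m (x : 'rV_m) : `|coord_vec l x| ^+ 2 = dotmx x x.
Proof. by rewrite hdot dot_coord_vec. Qed.

Lemma coord_vecK l m (x : 'rV_m) : coords l m (coord_vec l x) = x.
Proof.
apply/rowP => i; rewrite mxE /coord_vec linear_sumlz (bigD1 i)//= linearZl_LR /= eo eqxx.
rewrite mulr1 big1 ?addr0// => j ji; rewrite linearZl_LR /= eo eqn_add2l.
by rewrite (_ : (j == i :> nat) = false) ?mulr0//; apply/negbTE.
Qed.

Lemma coord_vec_coords l m z : coord_vec l (coords l m z) = P (l + m) z - P l z.
Proof.
rewrite /proj (big_cat_nat (leq0n l) (leq_addr m l)) /= [X in X - _]addrC addrK.
rewrite [RHS](_ : _ = \sum_(0 + l <= i < l + m) dot z (e i) *: e i)//.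
rewrite big_addn addKn big_mkord; apply: eq_bigr => i _.
by rewrite mxE addnC.
Qed.

(** Row [i] holds the image of the [i]-th basis vector, because matrices act on row vectors from the
    right. *)
Definition opmx (l m l' m' : nat) (f : H -> H) : 'M[C]_(m, m') :=
  \matrix_(i, j) dot (f (e (l + i)%N)) (e (l' + j)%N).

Lemma mul_opmx l m l' m' f (x : 'rV_m) : linear f ->
  x *m opmx l m l' m' f = coords l' m' (f (coord_vec l x)).
Proof.
move=> lf; have f0 : f 0 = 0.
  by have := lf (-1) 0 0; rewrite scaler0 addr0 scaleN1r addNr.
have -> : f (coord_vec l x) = \sum_(i < m) x 0 i *: f (e (l + i)%N).
  by rewrite /coord_vec; elim/big_rec2: _ => [//|i y z _ <-]; rewrite lf.
apply/rowP => j; rewrite !mxE linear_sumlz; apply: eq_bigr => i _.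
by rewrite linearZl_LR mxE.
Qed.

Lemma dotmx_row_mx n m (x : 'rV[C]_n) (y : 'rV_m) :
  dotmx (row_mx x y) (row_mx x y) = dotmx x x + dotmx y y.
Proof. by rewrite !dotmxE tr_row_mx map_col_mx mul_row_col mxE. Qed.

(* [g] is the right inverse; since [f] has at most [z] independent coordinates,
   its kernel leaves room for [g] and for a small [d]. *)
Lemma perturb_diagonal_block (l m z : nat) (a f : 'I_2 -> H -> H) (eps : C) :
    0 < eps -> (z <= m)%N ->
    (forall i, linear (a i)) -> (forall i, linear (f i)) ->
    (forall i x, P z (f i x) = f i x) ->
  let Q x := P (l + m) x - P l x in
  exists g : 'I_2 -> H -> H, exists d : 'I_2 -> H -> H,
    [/\ (forall i, linear (g i)) /\ (forall i, linear (d i)),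
        forall i x, Q (g i x) = g i x /\ Q (d i x) = d i x,
        forall i x, `|g i x| <= eps^-1 * `|Q x| /\ `|d i x| <= eps * `|Q x|,
        forall x, Q (\sum_i (a i (g i x) + d i (g i x))) = Q x &
        forall x, \sum_i f i (g i x) = 0].
Proof.
move=> eps0 zm la lf Pf Q; pose al i := opmx l m l m (a i).
pose S i := opmx l m 0 z (f i).
(* The two diagonal blocks are stacked into [m + m] rows, and the [f i] into [z] columns to be
   annihilated; [z <= m] leaves the room required. *)
have [|G [D [GMD GS nG nD]]] := perturb_right_inverse (col_mx (al 0) (al 1))
    (col_mx (S 0) (S 1)) eps0 (_ : m + z <= m + m)%N; first by rewrite leq_add2l.
pose Gi (i : 'I_2) : 'M[C]_m := if i == 0 then lsubmx G else rsubmx G.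
pose Di (i : 'I_2) : 'M[C]_m := if i == 0 then usubmx D else dsubmx D.
have QE x : Q x = coord_vec l (coords l m x) by rewrite coord_vec_coords.
have sum2 (V : nmodType) (F : 'I_2 -> V) : \sum_i F i = F 0 + F 1.
  by rewrite !big_ord_recl big_ord0 addr0; congr (_ + F _); exact: val_inj.
have lin (B : 'M[C]_m) : linear (fun x => coord_vec l (coords l m x *m B)).
  by move=> c x y; rewrite coords_linear mulmxDl -scalemxAl coord_vec_linear.
have Qcoord_vec (x : 'rV_m) : Q (coord_vec l x) = coord_vec l x by rewrite QE coord_vecK.
exists (fun i x => coord_vec l (coords l m x *m Gi i)),
  (fun i x => coord_vec l (coords l m x *m Di i)).
have nG' i (x : 'rV_m) : dotmx (x *m Gi i) (x *m Gi i) <= eps^-1 ^+ 2 * dotmx x x.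
  apply: le_trans (nG x); rewrite -[G]hsubmxK mul_mx_row dotmx_row_mx /Gi.
  by case: (i == 0); [rewrite lerDl|rewrite lerDr]; exact: dnorm_ge0.
have nD' i (x : 'rV_m) : dotmx (x *m Di i) (x *m Di i) <= eps ^+ 2 * dotmx x x.
  have -> : x *m Di i = (if i == 0 then row_mx x 0 else row_mx 0 x) *m D.
    rewrite -[D]vsubmxK /Di; case: (i == 0);
      by rewrite mul_row_col ?col_mxKu ?col_mxKd mul0mx ?addr0 ?add0r.
  apply: le_trans (nD _) _; rewrite ler_wpM2l ?exprn_ge0 ?(ltW eps0)//.
  by case: (i == 0); rewrite dotmx_row_mx linear0l ?addr0 ?add0r.
have nrm (B : 'M[C]_m) (c : C) x : 0 < c ->
    (forall x : 'rV_m, dotmx (x *m B) (x *m B) <= c ^+ 2 * dotmx x x) ->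
    `|coord_vec l (coords l m x *m B)| <= c * `|Q x|.
  move=> c0 hB; rewrite -ler_sqr ?nnegrE ?mulr_ge0 ?(ltW c0)//.
  by rewrite exprMn QE !sqr_norm_coord_vec.
split.
- by split=> i; exact: lin.
- by move=> i x; rewrite !Qcoord_vec.
- by move=> i x; split; apply: nrm => //; rewrite invr_gt0.
- move=> x; rewrite QE [RHS]QE; congr coord_vec.
  have -> : coords l m (\sum_i (a i (coord_vec l (coords l m x *m Gi i)) +
      coord_vec l (coords l m (coord_vec l (coords l m x *m Gi i)) *m Di i))) =
      \sum_i (coords l m x *m Gi i) *m (al i + Di i).
    rewrite !sum2.
    have coordsD u v : coords l m (u + v) = coords l m u + coords l m v.
      by have := coords_linear l m 1 u v; rewrite !scale1r.
    by rewrite !coordsD !coord_vecK !mulmxDr /al !mul_opmx.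
  rewrite sum2 -!mulmxA -mulmxDr -[RHS]mulmx1; congr (_ *m _).
  rewrite -GMD -[in RHS](hsubmxK G) -[in RHS](vsubmxK D) add_col_mx mul_row_col.
  by rewrite /Gi /Di /=.
- move=> x; have h : coords 0 z (\sum_i f i (coord_vec l (coords l m x *m Gi i))) = 0.
    have -> : coords 0 z (\sum_i f i (coord_vec l (coords l m x *m Gi i))) =
        \sum_i (coords l m x *m Gi i) *m S i.
      rewrite !sum2.
      have coordsD u v : coords 0 z (u + v) = coords 0 z u + coords 0 z v.
        by have := coords_linear 0 z 1 u v; rewrite !scale1r.
      by rewrite coordsD /S !mul_opmx.
    rewrite sum2 -!mulmxA -mulmxDr (_ : _ + _ = 0) ?mulmx0//.
    by rewrite -[RHS]GS -[in RHS](hsubmxK G) mul_row_col.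
  have h0 := coord_vec_coords 0 z (\sum_i f i (coord_vec l (coords l m x *m Gi i))).
  rewrite h add0n in h0.
  (* The values of the [f i] lie in the span of the first [z] vectors, so it is enough that these
     coordinates vanish. *)
  have -> : \sum_i f i (coord_vec l (coords l m x *m Gi i)) =
      P z (\sum_i f i (coord_vec l (coords l m x *m Gi i))).
    by rewrite proj_sum; apply: eq_bigr => i _.
  have proj_s0 y : P 0 y = 0 by rewrite /proj big_geq.
  rewrite proj_s0 subr0 in h0; rewrite -h0.
  by have := coord_vec_linear 0 (-1) 0 (0 : 'rV_z); rewrite scaler0 addr0 scaleN1r addNr.
Qed.

End local_coordinates.

(** * Density of right unimodular pairs *)

Section density.
Context {R : realType} (H : completeNormedModType R[i])
  (dot : {dot H for conjC}) (hdot : hilbert_product dot).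
Local Notation C := R[i].
Context (e : nat -> H) (eo : forall u v, dot (e u) (e v) = (u == v)%:R).
Local Notation P := (proj dot e).
Context (N : omega_nest H) (s : nat -> nat)
  (NE : forall k x, N k x <-> P (s k) x = x)
  (s0 : s 0%N = 0%N) (s_lt : forall k, (s k < s k.+1)%N).
Local Notation Q := (block dot e s).

Lemma s_mono : {homo s : i j / (i <= j)%N}.
Proof. by apply: homo_leq => // [i j k|i]; [exact: leq_trans|exact: ltnW]. Qed.

Lemma s_ge k : (k <= s k)%N.
Proof. by elim: k => // k IH; exact: leq_ltn_trans IH (s_lt k). Qed.

Lemma proj_s0 x : P (s 0%N) x = 0.
Proof. by rewrite s0 /proj big_geq. Qed.

Lemma block_linear k : linear (Q k).
Proof.
move=> a x y; rewrite /block !(proj_linear dot e).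
by rewrite scalerBr opprD addrACA.
Qed.

Lemma proj_block i k x : P (s i) (Q k x) = if (k < i)%N then Q k x else 0.
Proof.
rewrite /block projB !(projM eo); case: ltnP => ki.
  by rewrite !(minn_idPr _) ?s_mono// ltnW.
by rewrite !(minn_idPl _) ?subrr ?s_mono// ltnW.
Qed.

Lemma block_block j k x : Q j (Q k x) = if j == k then Q k x else 0.
Proof.
rewrite {1}/block !proj_block ltnS; case: (ltngtP j k) => jk; last by rewrite subr0.
  by rewrite subr0.
by rewrite subrr.
Qed.

Lemma block_proj j k x : Q j (P (s k) x) = if (j < k)%N then Q j x else 0.
Proof.
rewrite /block !(projM eo); case: ltnP => jk.
  by rewrite !(minn_idPl _) ?s_mono// ltnW.
by rewrite !(minn_idPr _) ?subrr ?s_mono// ltnW.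
Qed.

Lemma block_le k x : `|Q k x| <= `|x|.
Proof.
have -> : Q k x = P (s k.+1) x - P (s k) (P (s k.+1) x).
  by rewrite (projM eo) (minn_idPl _)// s_mono.
by rewrite (le_trans (projC_le hdot eo _ _))// proj_le.
Qed.

Lemma nest_block k x : N k.+1 (Q k x).
Proof. by apply/NE; rewrite proj_block ltnSn. Qed.

Lemma nestD k x y : N k x -> N k y -> N k (x + y).
Proof. by move=> /NE Px /NE Py; apply/NE; rewrite projD Px Py. Qed.

Lemma nest0 k : N k 0.
Proof. by apply/NE; rewrite proj0. Qed.

(** The operator lives on the [d]-th diagonal above the main one: distinct blocks have images in
    distinct blocks, hence orthogonal. *)
Lemma exists_block_operator (d : nat) (M : C) (T : nat -> H -> H) :
    0 <= M -> (forall k, linear (T k)) ->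
    (forall k x, T k x = if (d <= k)%N then Q (k - d) (T k x) else 0) ->
    (forall k x, `|T k x| <= M * `|Q k x|) ->
  exists2 S : nest_algebra N, `|S| <= M & forall k x, S (Q k x) = T k x.
Proof.
move=> M0 lT QT bT.
(* The norm bound forces [T k x] to depend only on the [k]-th block of [x]. *)
have TQ k x y : Q k x = Q k y -> T k x = T k y.
  move=> xy; apply/eqP; rewrite -subr_eq0 -normr_le0.
  have -> : T k x - T k y = T k (x - y).
    by have := lT k (-1) y x; rewrite !scaleN1r addrC => <-; rewrite addrC.
  rewrite (le_trans (bT _ _))// (_ : Q k (x - y) = 0) ?normr0 ?mulr0//.
  by have := block_linear k (-1) y x; rewrite !scaleN1r addrC xy subrr [- y + x]addrC.
have T0 k x : Q k x = 0 -> T k x = 0.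
  by move=> Q0; apply/eqP; rewrite -normr_le0 (le_trans (bT _ _))// Q0 normr0 mulr0.
have [S SM SE] : exists2 S : nest_algebra N, `|S| <= M &
    forall K x, P (s K) x = x -> S x = \sum_(0 <= k < K) T k x.
  apply: (@exists_orthogonal_sum _ _ dot hdot e eo N s NE s T M) => //.
  - exact: s_ge.
  - exact: s_mono.
  - move=> j k x y jk; rewrite QT [T k y]QT.
    case: leqP => dj; last by rewrite linear0l.
    case: leqP => dk; last by rewrite linear0r.
    apply: dot_block => //; first exact: s_mono.
    by apply: contra jk => /eqP h; apply/eqP; rewrite -(subnK dj) h subnK.
  - move=> j k x Nx; have [kj|jk] := leqP k j.
      rewrite T0; first exact: nest0.
      by move/NE: Nx => <-; rewrite block_proj ltnNge kj.
    rewrite QT; case: leqP => dj; last exact: nest0.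
    by apply: nest_mono (nest_block _ _); rewrite (leq_ltn_trans (leq_subr _ _)).
exists S => // k x; rewrite (SE k.+1); last by rewrite proj_block ltnSn.
rewrite big_nat_recr //= big_nat_cond big1 => [|j /andP[/andP[_ jk] _]].
  by rewrite add0r; apply: TQ; rewrite block_block eqxx.
by apply: T0; rewrite block_block ltn_eqF.
Qed.

Lemma sum_blocks k x : N k x -> \sum_(0 <= j < k) Q j x = x.
Proof. by move=> /NE Px; rewrite sum_block// proj_s0 subr0. Qed.

Lemma sum_window q k y : (N k.+1 y) ->
  \sum_(0 <= d < q.+1) (if (d <= k)%N then Q (k - d) y else 0) = y - P (s (k - q)) y.
Proof.
move=> /NE Py; elim: q => [|q IH].
  by rewrite big_nat1 leq0n subn0 /block Py.
rewrite big_nat_recr //= IH; case: ifPn => qk.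
  by rewrite /block -subSn// subSS addrA subrK.
by rewrite addr0 (_ : k - q = k - q.+1)%N//; lia.
Qed.

(** Block [k] has at least the dimension of [N (k - q)], which is the room needed to confine the
    [k]-th column of an inverse to the blocks from [k - q] to [k]. With [X] the product of the
    perturbed row and the block diagonal [Ga], that inverse [V] has [q.+1] diagonals, so it is
    bounded, and the entries [nest_mul (Ga i) V] give a right inverse. *)
Lemma dense_right_unimodular2 (q : nat) :
    (forall k, s (k - q) <= s k.+1 - s k)%N ->
  dense (@right_unimodular R (nest_banach_algebra N) 2).
Proof.
move=> hq O [a Oa] Oopen.
have /nbhs_ballP[eps0 /= eps00 ballO] : nbhs a O by exact: open_nbhs_nbhs.
pose eps := eps0 / 2; have eps_gt0 : 0 < eps by rewrite divr_gt0.
pose A i : nest_algebra N := a ord0 i.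
have PW k W : linear W ->
    forall i, linear (fun x => P (s (k - q)) (W (P (s k) (A i x)))).
  by move=> lW i c x y; rewrite nest_op_linear proj_linear lW proj_linear.
(* The choice is made for every [k] and every map [W], with default 0 when [W] is not linear: the
   actual [W] is built recursively from earlier choices and shown linear only afterwards. *)
have /choice[g hg] : forall kW : nat * (H -> H),
    exists g : 'I_2 -> H -> H, linear kW.2 -> exists d : 'I_2 -> H -> H,
    [/\ (forall i, linear (g i)) /\ (forall i, linear (d i)),
        forall i x, Q kW.1 (g i x) = g i x /\ Q kW.1 (d i x) = d i x,
        forall i x, `|g i x| <= eps^-1 * `|Q kW.1 x| /\ `|d i x| <= eps * `|Q kW.1 x|,
        forall x, Q kW.1 (\sum_i (A i (g i x) + d i (g i x))) = Q kW.1 x &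
        forall x, \sum_i P (s (kW.1 - q)) (kW.2 (P (s kW.1) (A i (g i x)))) = 0].
  move=> [k W]; case: (pselect (linear W)) => [lW|nlW]; last by exists (fun _ _ => 0).
  have := @perturb_diagonal_block _ _ dot hdot e eo (s k) (s k.+1 - s k) (s (k - q)) A
    (fun i x => P (s (k - q)) (W (P (s k) (A i x)))) eps eps_gt0 (hq k)
    (fun i => @nest_op_linear _ _ N (A i)) (PW k W lW).
  rewrite subnKC ?s_mono// => -[|h [d hd]].
    by move=> i x; rewrite (projM eo) minnn.
  by exists h => _; exists d.
(* The part of the [k]-th column of the future product [X] strictly above the diagonal. *)
pose u k W x := P (s k) (\sum_i A i (g (k, W) i x)).
(* [Wseq k] will invert [X] on [N k]. As [X] adds to a vector of block [k] its strictly upper part,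
   this part is subtracted before the previous inverse is applied. *)
pose fix Wseq k := if k is k'.+1
  then fun x => Wseq k' (x - u k' (Wseq k') x) + Q k' x else fun=> 0.
have lW k : linear (Wseq k).
  elim: k => [|k IH] c x y; first by rewrite /= scaler0 addr0.
  have [d [[lg _] _ _ _ _]] := hg (k, Wseq k) IH.
  have ul : u k (Wseq k) (c *: x + y) = c *: u k (Wseq k) x + u k (Wseq k) y.
    rewrite /u -proj_linear scaler_sumr -big_split /=; congr (P _ _).
    by apply: eq_bigr => i _; rewrite lg nest_op_linear.
  have lx : c *: x + y - (c *: u k (Wseq k) x + u k (Wseq k) y) =
      c *: (x - u k (Wseq k) x) + (y - u k (Wseq k) y).
    by rewrite scalerBr opprD addrACA.
  by rewrite /= ul block_linear lx IH [in RHS](scalerDr c (Wseq k _) (Q k x)) addrACA.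
have /choice[d hd0] k := hg (k, Wseq k) (lW k).
pose gk k i := g (k, Wseq k) i; pose uk k := u k (Wseq k).
have ukE k x : uk k x = P (s k) (\sum_i A i (gk k i x)) by [].
have hd k : [/\ (forall i, linear (gk k i)) /\ (forall i, linear (d k i)),
    forall i x, Q k (gk k i x) = gk k i x /\ Q k (d k i x) = d k i x,
    forall i x, `|gk k i x| <= eps^-1 * `|Q k x| /\ `|d k i x| <= eps * `|Q k x|,
    forall x, Q k (\sum_i (A i (gk k i x) + d k i (gk k i x))) = Q k x &
    forall x, \sum_i P (s (k - q)) (Wseq k (P (s k) (A i (gk k i x)))) = 0].
  exact: hd0.
have W0 k : Wseq k 0 = 0 by have := lW k (-1) 0 0; rewrite scaler0 addr0 scaleN1r addNr.
have WB k x y : Wseq k (x - y) = Wseq k x - Wseq k y.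
  by rewrite -scaleN1r addrC lW scaleN1r addrC.
have Wsum k (F : 'I_2 -> H) : Wseq k (\sum_i F i) = \sum_i Wseq k (F i).
  elim/big_rec2: _ => [//|i y1 y2 _ <-].
  by have := lW k 1 (F i) y2; rewrite !scale1r.
have gQ0 k i x : Q k x = 0 -> gk k i x = 0.
  have [_ _ /(_ i x)[bg _] _ _] := hd k => Q0.
  by apply/eqP; rewrite -normr_le0 (le_trans bg)// Q0 normr0 mulr0.
have uQ0 k x : Q k x = 0 -> uk k x = 0.
  move=> Q0; rewrite ukE big1 ?proj0// => i _.
  by rewrite (gQ0 k i x Q0) nest_op0.
have eps'0 : 0 <= eps^-1 by rewrite invr_ge0 ltW.
have /choice[Ga GaE] i : exists S : nest_algebra N, forall k x, S (Q k x) = gk k i x.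
  have [||k x|k x|S _ SE] := @exists_block_operator 0 eps^-1 (fun k => gk k i) => //.
  - by move=> k; have [[lg _] _ _ _ _] := hd k; exact: lg.
  - by have [_ /(_ i x)[E _] _ _ _] := hd k; rewrite subn0 E.
  - by have [_ _ /(_ i x)[bg _] _ _] := hd k.
  by exists S.
have /choice[De DeE] i : exists S : nest_algebra N, `|S| <= eps /\
    forall k x, S (Q k x) = d k i x.
  have [||k x|k x|S nS SE] := @exists_block_operator 0 eps (fun k => d k i).
  - exact: ltW.
  - by move=> k; have [[_ ld] _ _ _ _] := hd k; exact: ld.
  - by have [_ /(_ i x)[_ E] _ _ _] := hd k; rewrite subn0 E.
  - by have [_ _ /(_ i x)[_ bd] _ _] := hd k.
  by exists S.
pose X : nest_algebra N := \sum_i nest_mul (A i + De i) (Ga i).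
have XE x : X x = \sum_i (A i (Ga i x) + De i (Ga i x)) by rewrite /X nest_sumE.
have XQ k x : X (Q k x) = Q k x + uk k x.
  have [[lg ld] Qgd bgd Qx _] := hd k.
  have -> : X (Q k x) = \sum_i (A i (gk k i x) + d k i (gk k i x)).
    rewrite XE; apply: eq_bigr => i _; rewrite GaE; congr (_ + _).
    by have [Qg _] := Qgd i x; rewrite -[in LHS]Qg (DeE i).2.
  set y := \sum_i _.
  have Ny : N k.+1 y.
    rewrite /y; elim/big_rec: _ => [|i z _ Nz]; first exact: nest0.
    apply: nestD => //; apply: nestD.
      by apply: nest_op_invariant; have [<- _] := Qgd i x; exact: nest_block.
    by have [_ <-] := Qgd i (gk k i x); exact: nest_block.
  have yE : y = Q k y + P (s k) y by move/NE: Ny => Ny; rewrite /block Ny subrK.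
  rewrite yE /y Qx; congr (_ + _); rewrite ukE !proj_sum; apply: eq_bigr => i _.
  rewrite projD; have [_ Qd] := Qgd i (gk k i x); rewrite -Qd proj_block ltnn addr0.
  by [].
have XW k x : X (Wseq k x) = P (s k) x.
  elim: k x => [|k IH] x; first by rewrite nest_op0 proj_s0.
  rewrite /= nest_op_add IH XQ projB -/(uk k) [in P _ (uk k x)]ukE (projM eo) minnn -ukE.
  by rewrite addrCA subrK /block subrK.
have NW k x : N k (Wseq k x).
  elim: k x => [|k IH] x; first exact: nest0.
  by apply: nestD; [exact: nest_mono (IH _)|exact: nest_block].
have WQ j k x : (k <= j)%N -> Wseq k (Q j x) = 0.
  elim: k => // k IH kj; have kj' : Q k (Q j x) = 0 by rewrite block_block ltn_eqF.
  by rewrite /= -/(uk k) uQ0// subr0 IH ?(ltnW kj)// kj' addr0.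
(* The [k]-th column of the inverse of [X]. *)
pose v k x := Wseq k.+1 (Q k x).
have vE k x : v k x = Q k x - Wseq k (uk k (Q k x)).
  by rewrite /v /= WB WQ// sub0r block_block eqxx addrC.
have Xv k x : X (v k x) = Q k x by rewrite /v XW proj_block ltnSn.
have Nv k x : N k.+1 (v k x) by exact: NW.
(* The condition imposed on [gk] at stage [k] makes this column vanish on the blocks before
   [k - q]. *)
have Pv k x : P (s (k - q)) (v k x) = 0.
  rewrite vE projB proj_block ltnNge leq_subr /= sub0r.
  have [_ _ _ _ /(_ (Q k x)) hP] := hd k.
  by rewrite ukE proj_sum Wsum proj_sum hP oppr0.
pose c := 1 + `|X|.
have c1 : 1 <= c by rewrite lerDl.
(* Each further block multiplies the bound by at most [c]: [X] sends [v k x] into block [k], so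
   block [i] of [v k x] has to cancel what [X] brings there from the later blocks. *)
have tail k x j : (j <= k)%N ->
    `|v k x - P (s (k - j)) (v k x)| <= c ^+ j * `|Q k x|.
  elim: j => [_|j IH jk].
    rewrite subn0 mul1r vE projB proj_block ltnn sub0r opprK.
    by have /NE -> := NW k (uk k (Q k x)); rewrite subrK.
  have [i ik] : exists i, (k - j = i.+1)%N by exists (k - j).-1; lia.
  have -> : (k - j.+1 = i)%N by lia.
  have {IH} := IH (ltnW jk); rewrite ik.
  move: (v k x) (Xv k x) => y Xy IH.
  set t := y - P (s i.+1) y in IH *.
  have yE : y - P (s i) y = Q i y + t by rewrite /t /block [RHS]addrC addrA subrK.
  have QX : Q i y = - Q i (X t).
    have QD (z w : H) : Q i (z + w) = Q i z + Q i w.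
      by have := block_linear i 1 z w; rewrite !scale1r.
    have h : Q i (X y) = 0 by rewrite Xy block_block ltn_eqF//; lia.
    have hP : Q i (X (P (s i) y)) = 0.
      have /NE <- : N i (X (P (s i) y)) by apply: nest_op_invariant; exact: proj_in.
      by rewrite block_proj ltnn.
    have hQ : Q i (X (Q i y)) = Q i y.
      rewrite XQ QD block_block eqxx; have -> : Q i (uk i y) = 0.
        by rewrite ukE block_proj ltnn.
      by rewrite addr0.
    have yE2 : y = P (s i) y + (Q i y + t) by rewrite -yE addrC subrK.
    have h2 : Q i (X (P (s i) y + (Q i y + t))) = 0 by rewrite -yE2.
    rewrite (nest_op_add X (P (s i) y)) (nest_op_add X (Q i y)) in h2.
    rewrite (QD (X (P (s i) y))) (QD (X (Q i y))) hP hQ add0r in h2.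
    by apply/eqP; rewrite -addr_eq0 h2.
  rewrite yE (le_trans (ler_normD _ _))// QX normrN exprS -mulrA.
  apply: (@le_trans _ _ (c * `|t|)); last first.
    by rewrite ler_wpM2l// (le_trans ler01).
  rewrite /c mulrDl mul1r addrC lerD2l (le_trans (block_le _ _))//.
  exact: nest_op_le.
have vb k x : `|v k x| <= c ^+ q * `|Q k x|.
  (* [k - (k - q)] is the smaller of [k] and [q], the number of steps that covers the whole
     column. *)
  have := tail k x (k - (k - q))%N (leq_subr _ _).
  rewrite subKn ?leq_subr// Pv subr0 => /le_trans; apply.
  by rewrite ler_wpM2r// ler_weXn2l//; lia.
have lv k : linear (v k) by move=> z x y; rewrite /v block_linear lW.
have cq0 : 0 <= c ^+ q by rewrite exprn_ge0// (le_trans ler01).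
(* The columns are cut into diagonals, on each of which a uniform bound on the columns bounds the
   operator. *)
have /choice[S SE] r : exists S : nest_algebra N, forall k x,
    S (Q k x) = if (r <= k)%N then Q (k - r) (v k x) else 0.
  have [||k x|k x|S _ SE] := @exists_block_operator r (c ^+ q)
      (fun k x => if (r <= k)%N then Q (k - r) (v k x) else 0) => //.
  - move=> k z x y; case: leqP => _; last by rewrite scaler0 addr0.
    by rewrite lv block_linear.
  - by case: leqP => // _; rewrite block_block eqxx.
  - case: leqP => _; last by rewrite normr0 mulr_ge0.
    by rewrite (le_trans (block_le _ _)).
  by exists S.
pose V : nest_algebra N := \sum_(0 <= r < q.+1) S r.
have VQ k x : V (Q k x) = v k x.
  rewrite /V nest_sumE; transitivity (\sum_(0 <= r < q.+1)
      if (r <= k)%N then Q (k - r) (v k x) else 0); first by apply: eq_bigr => r _.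
  by rewrite sum_window// Pv subr0.
exists (\row_i (A i + De i)); split.
  apply: ballO; split=> // i j; rewrite -ball_normE /ball_ /= ord1 mxE.
  rewrite opprD addrA [X in `|X|](_ : _ = - De j); last by rewrite subrr add0r.
  rewrite normrN (le_lt_trans (DeE j).1)// /eps.
  by rewrite ltr_pdivrMr// ltr_pMr// ltr1n.
exists (\row_i nest_mul (Ga i) V).
apply: (eq_nest_op hdot eo NE) => k x Nx.
have -> : (\sum_(i < 2)
    ba_mul ((\row_i0 (A i0 + De i0)) ord0 i : nest_banach_algebra N)
    ((\row_i0 nest_mul (Ga i0) V) ord0 i : nest_banach_algebra N) : nest_algebra N) x = X (V x).
  rewrite nest_sumE XE; apply: eq_bigr => i _; rewrite !mxE.
  by [].
rewrite -(sum_blocks Nx) !nest_op_sum; apply: eq_bigr => j _.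
by rewrite VQ Xv.
Qed.

End density.

(** * Growth of the dimensions *)

Section combinatorics.
Context (s : nat -> nat) (s0 : s 0%N = 0%N) (s_lt : forall k, (s k < s k.+1)%N).

Let s_mono : {homo s : i j / (i <= j)%N}.
Proof. exact: s_mono. Qed.

Let s_inj i j : s i = s j -> i = j.
Proof.
have lt a b : (a < b)%N -> (s a < s b)%N.
  by move=> ab; rewrite (leq_trans (s_lt a))// s_mono.
by move=> h; case: (ltngtP i j) => // /lt; rewrite h ltnn.
Qed.

(** Only the first index of each atom moves, so the map exists whatever the dimensions of the
    atoms. *)
Lemma exists_one_shift : exists f : nat -> option nat,
  [/\ f 0%N = None, forall k, f (s k.+1) = Some (s k) &
      forall u, (forall k, u != s k) -> f u = Some u].
Proof.
pose p u k := s k.+1 == u.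
exists (fun u => if u == 0%N then None else
  if pselect (exists k, p u k) is left ex then Some (s (ex_minn ex)) else Some u).
split=> [//|k|u us].
  rewrite gtn_eqF ?(leq_ltn_trans _ (s_lt k))//.
  case: pselect => [ex|[]]; last by exists k; rewrite /p.
  by case: ex_minnP => j /eqP/s_inj[->].
rewrite -{1}s0 (negPf (us 0%N)); case: pselect => // ex.
by have [k /eqP ku] := ex; have := us k.+1; rewrite ku eqxx.
Qed.

(** Index [s L] is reached only from [s L.+1], which lies beyond [N L.+1], and no index moves back
    by more than one atom. *)
Lemma one_shift_obstruction : exists f : 'I_1 -> nat -> option nat,
  [/\ forall i i' u u' v, f i u = Some v -> f i' u' = Some v -> i = i' /\ u = u',
      forall i u v k, f i u = Some v -> (u < s k)%N -> (v < s k)%N &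
      forall L, exists k : nat -> nat, exists v0,
      [/\ (v0 < s (k L))%N, forall j, (j < L)%N -> (s (k j) <= v0)%N,
          forall i u, (u < s (k L))%N -> f i u <> Some v0 &
          forall j i u, (j < L)%N -> (s (k j.+1) <= u < s (k L))%N ->
            exists2 v, f i u = Some v & (s (k j) <= v)%N]].
Proof.
have [f [f0 fS fu]] := exists_one_shift.
have fP u : [\/ u = 0%N, exists k, u = s k.+1 | forall k, u != s k].
  have [[k uk]|h] := pselect (exists k, u = s k).
    by case: k uk => [|k] uk; [apply: Or31; rewrite uk s0|apply: Or32; exists k].
  by apply: Or33 => k; apply/eqP => uk; apply: h; exists k.
exists (fun=> f); split.
- move=> i i' u u' v; rewrite !ord1 => fuv fuv'; split=> //.
  have [u0|[k uk]|hu] := fP u; first by rewrite u0 f0 in fuv.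
    have [u0|[k' uk']|hu'] := fP u'; first by rewrite u0 f0 in fuv'.
      move: fuv fuv'; rewrite uk uk' !fS => -[<-] [] /s_inj ->.
      by [].
    move: fuv fuv'; rewrite uk fS (fu _ hu') => -[<-] [] h.
    by have := hu' k; rewrite h eqxx.
  have [u0|[k' uk']|hu'] := fP u'; first by rewrite u0 f0 in fuv'.
    move: fuv fuv'; rewrite uk' fS (fu _ hu) => -[<-] [] h.
    by have := hu k'; rewrite h eqxx.
  by move: fuv fuv'; rewrite (fu _ hu) (fu _ hu') => -[->] [->].
- move=> _ u v k fuv; have [u0|[k' uk]|hu] := fP u; first by rewrite u0 f0 in fuv.
    by move: fuv; rewrite uk fS => -[<-]; apply: ltn_trans.
  by move: fuv; rewrite (fu _ hu) => -[->].
- move=> L; exists S, (s L); split=> //.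
  + by move=> j jL; exact: s_mono.
  + move=> _ u uL fuv; have [u0|[k' uk]|hu] := fP u; first by rewrite u0 f0 in fuv.
      by move: fuv; rewrite uk fS => -[/s_inj k'L]; rewrite uk k'L ltnn in uL.
    by move: fuv; rewrite (fu _ hu) => -[uE]; have := hu L; rewrite uE eqxx.
  + move=> j _ u jL /andP[ju uL]; have [u0|[k' uk]|hu] := fP u.
    * by move: ju; rewrite u0 leqNgt (leq_ltn_trans _ (s_lt _)).
    * exists (s k'); first by rewrite uk fS.
      apply: s_mono; rewrite leqNgt; apply/negP => kj; move: ju.
      by rewrite uk leqNgt (leq_ltn_trans (s_mono _) (s_lt _)).
    * exists u; first exact: fu.
      by rewrite (leq_trans _ ju)// ltnW.
Qed.

(** Distances counted in indices and in atoms agree up to a factor 2, after scaling by [2 ^ J]. *)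
Lemma dyadic_growth (J k0 a : nat) :
    (forall k, (k0 <= k < k0 + a)%N ->
      (2 ^ J < 2 * (s k.+1 - s k))%N /\ (s k.+1 - s k <= 2 ^ J)%N) ->
  (a * 2 ^ J <= 2 * (s (k0 + a) - s k0))%N /\ (s (k0 + a) - s k0 <= a * 2 ^ J)%N.
Proof.
elim: a => [|a IH] h; first by rewrite addn0 subnn.
have [|lo hi] := IH; first by move=> k ?; apply: h; lia.
have [lo1 hi1] : (2 ^ J < 2 * (s (k0 + a).+1 - s (k0 + a)))%N /\
    (s (k0 + a).+1 - s (k0 + a) <= 2 ^ J)%N by apply: h; lia.
have h1 : (s k0 <= s (k0 + a))%N by apply: s_mono; rewrite leq_addr.
have h2 := s_lt (k0 + a).
by rewrite addnS mulSn; split; lia.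
Qed.

(** The [L]-th of a sequence of disjoint stretches has [B ^ L] atoms and ends at [E L]. There
    operator [i] sends the index at distance [t] from the end to the one at distance
    [4 * (n.+1 * t) + i]; the remainder [i] keeps the operators apart. The marks [k j] approach the
    end by a factor [B] in the number of atoms. *)
Lemma many_shifts_obstruction (n : nat) :
    (forall D k0, exists K, exists2 J, (k0 <= K)%N & forall k, (K <= k < K + D)%N ->
      (2 ^ J < 2 * (s k.+1 - s k))%N /\ (s k.+1 - s k <= 2 ^ J)%N) ->
  exists f : 'I_n.+1 -> nat -> option nat,
  [/\ forall i i' u u' v, f i u = Some v -> f i' u' = Some v -> i = i' /\ u = u',
      forall i u v k, f i u = Some v -> (u < s k)%N -> (v < s k)%N &
      forall L, exists k : nat -> nat, exists v0,
      [/\ (v0 < s (k L))%N, forall j, (j < L)%N -> (s (k j) <= v0)%N,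
          forall i u, (u < s (k L))%N -> f i u <> Some v0 &
          forall j i u, (j < L)%N -> (s (k j.+1) <= u < s (k L))%N ->
            exists2 v, f i u = Some v & (s (k j) <= v)%N]].
Proof.
(* 10 is 5, from [4 * (n.+1 * t) + i <= 5 * (n.+1 * t)], times 2 for the comparison of indices with
   atoms. *)
move=> hW; pose B := (10 * n.+1)%N.
have /choice[F hF] : forall Dk : nat * nat, exists KJ : nat * nat, (Dk.2 <= KJ.1)%N /\
    forall k, (KJ.1 <= k < KJ.1 + Dk.1)%N ->
      (2 ^ KJ.2 < 2 * (s k.+1 - s k))%N /\ (s k.+1 - s k <= 2 ^ KJ.2)%N.
  by move=> [D k0]; have [K [J h1 h2]] := hW D k0; exists (K, J).
pose fix KJ L := if L is L'.+1 then F (B ^ L, (KJ L').1 + B ^ L')%N else F (1%N, 0%N).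
pose K L := (KJ L).1; pose J L := (KJ L).2; pose E L := s (K L + B ^ L)%N.
have B0 L : (0 < B ^ L)%N by rewrite expn_gt0.
have KS L : (K L + B ^ L <= K L.+1)%N.
  by have [] := hF (B ^ L.+1, (KJ L).1 + B ^ L)%N.
have KJP L k : (K L <= k < K L + B ^ L)%N ->
    (2 ^ J L < 2 * (s k.+1 - s k))%N /\ (s k.+1 - s k <= 2 ^ J L)%N.
  case: L => [|L]; first by have [_] := hF (1%N, 0%N); apply.
  by have [_] := hF (B ^ L.+1, (KJ L).1 + B ^ L)%N; apply.
have KL L L' : (L < L')%N -> (E L <= s (K L'))%N.
  move=> LL'; apply: s_mono; elim: L' LL' => // L' IH; rewrite ltnS leq_eqVlt.
  move=> /predU1P[->//|/IH h].
  by rewrite (leq_trans h)// (leq_trans _ (KS L'))// leq_addr.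
have uniqL L L' w : (s (K L) <= w < E L)%N -> (s (K L') <= w < E L')%N -> L = L'.
  by move=> h h'; case: (ltngtP L L') => // /KL; lia.
(* An index whose image would fall before the stretch is left out, so that stretches do not
   interfere. *)
pose rel (i : 'I_n.+1) u v := exists L t,
  [/\ (0 < t)%N, (u + t = E L)%N, (v + (4 * (n.+1 * t) + i) = E L)%N & (s (K L) <= v)%N].
have relP i u v L t : (0 < t)%N -> (u + t = E L)%N ->
    (v + (4 * (n.+1 * t) + i) = E L)%N -> (v <= u)%N /\ (v < E L)%N.
  move=> t0 uE vE; have tn : (t <= n.+1 * t)%N by rewrite leq_pmull.
  lia.
have relF i u v v' : rel i u v -> rel i u v' -> v = v'.
  move=> [L [t [t0 uE vE vK]]] [L' [t' [t0' uE' vE' vK']]].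
  have [vu vL] := relP _ _ _ _ _ t0 uE vE; have [vu' vL'] := relP _ _ _ _ _ t0' uE' vE'.
  have LL' : L = L' by apply: (uniqL _ _ u); lia.
  subst L'; have tt' : t = t' by lia.
  subst t'; lia.
have relI i i' u u' v : rel i u v -> rel i' u' v -> i = i' /\ u = u'.
  move=> [L [t [t0 uE vE vK]]] [L' [t' [t0' uE' vE' vK']]].
  have [vu vL] := relP _ _ _ _ _ t0 uE vE; have [vu' vL'] := relP _ _ _ _ _ t0' uE' vE'.
  have LL' : L = L' by apply: (uniqL _ _ v); lia.
  subst L'; have iE : (4 * (n.+1 * t) + i = 4 * (n.+1 * t') + i')%N by lia.
  have lti := ltn_ord i; have lti' := ltn_ord i'.
  have tt' : t = t'.
    case: (ltngtP t t') => // lt.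
      have : (n.+1 * t.+1 <= n.+1 * t')%N by rewrite leq_mul2l lt orbT.
      by rewrite mulnS; lia.
    have : (n.+1 * t'.+1 <= n.+1 * t)%N by rewrite leq_mul2l lt orbT.
    by rewrite mulnS; lia.
  subst t'; split; last lia.
  by apply: val_inj => /=; lia.
have [f fP] : exists f : 'I_n.+1 -> nat -> option nat, forall i u v,
    f i u = Some v <-> rel i u v.
  exists (fun i u => if pselect (exists v, rel i u v) is left ex then
    Some (sval (cid ex)) else None) => i u v; case: pselect => [ex|nex].
    have hr := svalP (cid ex); split=> [[<-//]|hv].
    by congr Some; exact: relF hr hv.
  by split=> // hv; case: nex; exists v.
exists f; split.
- by move=> i i' u u' v /fP h /fP h'; exact: relI h h'.
- move=> i u v k /fP [L [t [t0 uE vE _]]].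
  by have [vu _] := relP _ _ _ _ _ t0 uE vE; exact: leq_ltn_trans.
(* [c j] counts the atoms from the mark [k j] to the end; it is 0 at [L], which puts [k L] at the
   end itself. *)
move=> L; pose c j := if (j < L)%N then (B ^ (L - j.+1))%N else 0%N.
pose k j := (K L + B ^ L - c j)%N.
have cB j : (c j <= B ^ L)%N.
  by rewrite /c; case: ifP => // _; rewrite leq_pexp2l// leq_subr.
have kLE : s (k L) = E L by rewrite /k /c ltnn subn0.
have KE : (s (K L) < E L)%N.
  by rewrite (leq_trans (s_lt _))// s_mono// -addn1 leq_add2l.
(* The last index is at distance 1 from the end, while images are at distance at least
   [4 * n.+1]. *)
exists k, (E L).-1; rewrite kLE; split.
- lia.
- move=> j jL; have -> : ((s (k j) <= (E L).-1) = (s (k j) < E L))%N by lia.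
  rewrite (leq_trans (s_lt _))// s_mono// /k /c jL.
  by have := B0 (L - j.+1)%N; have := B0 L; lia.
- move=> i u uL /fP [L' [t [t0 uE vE vK]]]; have [vu vL] := relP _ _ _ _ _ t0 uE vE.
  have LL' : L = L' by apply: (uniqL _ _ (E L).-1); lia.
  subst L'; have tn : (t <= n.+1 * t)%N by rewrite leq_pmull.
  lia.
move=> j i u jL /andP[ju uL].
have win a : (a <= B ^ L)%N -> (a * 2 ^ J L <= 2 * (E L - s (K L + B ^ L - a)))%N /\
    (E L - s (K L + B ^ L - a) <= a * 2 ^ J L)%N.
  move=> aB; have := @dyadic_growth (J L) (K L + B ^ L - a) a.
  rewrite subnK; last by rewrite (leq_trans aB)// leq_addl.
  by apply=> w hw; apply: KJP; lia.
have [_ hi] := win _ (cB j.+1); have [lo _] := win _ (cB j).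
rewrite -/(k j.+1) in hi; rewrite -/(k j) in lo.
have cj : (10 * (n.+1 * c j.+1) <= c j)%N.
  rewrite /c jL; case: ltnP => jL'; last by rewrite muln0.
  rewrite mulnA -/B -expnS; have -> : (L - j.+2).+1 = (L - j.+1)%N by lia.
  by [].
pose t := (E L - u)%N.
have tle : (t <= c j.+1 * 2 ^ J L)%N by rewrite /t; lia.
have t5 : (10 * (n.+1 * t) <= c j * 2 ^ J L)%N.
  apply: (@leq_trans (10 * (n.+1 * (c j.+1 * 2 ^ J L)))%N).
    by rewrite leq_mul2l leq_mul2l tle orbT.
  by rewrite [(n.+1 * _)%N]mulnA mulnA leq_mul2r cj orbT.
have t0 : (0 < t)%N by rewrite /t; lia.
have lti := ltn_ord i; have nt : (n.+1 <= n.+1 * t)%N by rewrite leq_pmulr.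
have kK : (s (K L) <= s (k j))%N by apply: s_mono; rewrite /k; have := cB j; lia.
exists (E L - (4 * (n.+1 * t) + i))%N; last lia.
by apply/fP; exists L, t; split; rewrite /t in t0 t5 nt *; lia.
Qed.

(** The dimension doubles every [p = 2 * D] atoms, so [s k.+1] is at most [2 * p] times the last
    dimension [m k]. Going back [2 * p] periods gains [2 ^ (2 * p)], which exceeds [2 * p]. *)
Lemma exists_domination_shift (D : nat) :
    (forall k, s k.+1 - s k <= s k.+2 - s k.+1)%N ->
    (forall k J, 2 ^ J < 2 * (s k.+1 - s k) -> s k.+1 - s k <= 2 ^ J ->
      2 ^ J < s (k + D).+1 - s (k + D))%N ->
  exists q, forall k, (s (k - q) <= s k.+1 - s k)%N.
Proof.
pose m k := (s k.+1 - s k)%N; rewrite -/m => m_le hD.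
have m_mono : {homo m : i j / (i <= j)%N}.
  by apply: homo_leq => [//|i j k|]; [exact: leq_trans|exact: m_le].
have m0 k : (0 < m k)%N by rewrite subn_gt0.
have mJ k : exists2 J, (2 ^ J < 2 * m k)%N & (m k <= 2 ^ J)%N.
  exists (up_log 2 (m k)); last exact: up_logP.
  have [m1|m1] := leqP (m k) 1.
    by have -> : m k = 1%N by have := m0 k; lia.
  have := @up_log_gtn 2 (m k) isT m1.
  have : (0 < up_log 2 (m k))%N by rewrite up_log_gt0.
  by case: (up_log 2 (m k)) => // J _ /=; rewrite expnS ltn_pmul2l.
have D0 : (0 < D)%N.
  rewrite lt0n; apply/eqP => D0; have [J h1 h2] := mJ 0%N.
  by have := hD 0%N J h1 h2; rewrite D0 addn0 -/(m _) ltnNge h2.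
(* One run of [D] atoms reaches a later dyadic block and a second one leaves that block, exceeding
   twice the initial dimension. *)
pose p := (2 * D)%N; have p0 : (0 < p)%N by rewrite /p; lia.
have m2 k : (2 * m k <= m (k + p))%N.
  have [J h1 h2] := mJ k; have h3 := hD k J h1 h2; rewrite -/(m _) in h3.
  have [J' h1' h2'] := mJ (k + D)%N; have h3' := hD _ J' h1' h2'; rewrite -/(m _) in h3'.
  have JJ' : (J < J')%N by rewrite -(ltn_exp2l J J' (isT : 1 < 2)%N); lia.
  have : (2 ^ J.+1 <= 2 ^ J')%N by rewrite leq_exp2l.
  have -> : (k + p = k + D + D)%N by rewrite /p; lia.
  by move: h3' h2; rewrite -/(m (k + D + D)%N) expnS; move: (m _) (m k) => a b; lia.
have mr r k : (2 ^ r * m k <= m (k + p * r))%N.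
  elim: r => [|r IH]; first by rewrite mul1n muln0 addn0.
  rewrite expnS -mulnA mulnS addnCA addnA [(p + _)%N]addnC addnAC.
  apply: leq_trans (m2 _); rewrite leq_mul2l /=; exact: IH.
have sa a k : (a <= k.+1)%N -> (s k.+1 <= s (k.+1 - a) + a * m k)%N.
  elim: a => [|a IH] ak; first by rewrite subn0 mul0n addn0.
  have := IH (ltnW ak); have -> : (k.+1 - a = (k - a).+1)%N by lia.
  have -> : (k.+1 - a.+1 = k - a)%N by lia.
  have : (m (k - a) <= m k)%N by apply: m_mono; rewrite leq_subr.
  have := s_lt (k - a); rewrite mulSn /m; lia.
(* The last [p] atoms contribute at most [p * m k], and those before at most
   [2 * p * m (k - p) <= p * m k]. *)
have s2p k : (s k.+1 <= 2 * p * m k)%N.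
  elim/ltn_ind: k => k IH; have [kp|pk] := ltnP k p.
    have := sa k.+1 k (leqnn _); rewrite subnn s0 add0n => /leq_trans; apply.
    by rewrite leq_mul2r; apply/orP; right; lia.
  have := sa p k (leqW pk); have -> : (k.+1 - p = (k - p).+1)%N by lia.
  have h1 := IH (k - p)%N ltac:(lia); have h2 := m2 (k - p)%N.
  rewrite subnK// in h2.
  have h3 : (p * (2 * m (k - p)) <= p * m k)%N by rewrite leq_mul2l h2 orbT.
  by move: h1; rewrite -!mulnA; lia.
exists (p * (2 * p))%N => k; have [kq|qk] := ltnP k (p * (2 * p)).
  rewrite (_ : k - _ = 0)%N ?s0//; lia.
have := mr (2 * p)%N (k - p * (2 * p))%N; rewrite subnK// -/(m k); apply: leq_trans.
rewrite (leq_trans (ltnW (s_lt _)))// (leq_trans (s2p _))// leq_mul2r.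
by rewrite ltnW ?orbT// ltn_expl.
Qed.

End combinatorics.

(** * Dyadic counts and runs of comparable dimensions *)

Section dyadic_blocks.
Context {R : realType} (n : nat -> nat).

Lemma counting_le (X : set nat) (r : seq nat) :
  X `<=` [set` r] -> (counting X <= (size r)%:R%:E :> \bar R)%E.
Proof.
move=> Xr; have Xf : finite_set X by apply: sub_finite_set Xr _; exact: finite_seq.
rewrite /counting asboolT// lee_fin ler_nat.
apply: uniq_leq_size; first exact: finmap.fset_uniq.
by move=> x; rewrite in_fset_set// inE => /Xr.
Qed.

Lemma counting_ge (X : set nat) (r : seq nat) :
  uniq r -> [set` r] `<=` X -> ((size r)%:R%:E <= counting X :> \bar R)%E.
Proof.
move=> ur rX; rewrite /counting; case: asboolP => [Xf|_]; last by rewrite leey.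
rewrite lee_fin ler_nat; apply: uniq_leq_size => // x xr.
by rewrite in_fset_set// inE; exact: rX.
Qed.

(** Doubling the lower inequality avoids the negative exponent at [j = 0]. *)
Definition dyadic_block (j : nat) : set nat :=
  [set k | (1 <= k)%N /\ ((2 ^ j < 2 * n k) && (n k <= 2 ^ j))%N].

Lemma dyadic_countE j : dyadic_count n j = counting (dyadic_block j) :> \bar R.
Proof.
rewrite /dyadic_count; congr counting; apply/seteqP.
have E k : ((2 : R) ^ (j%:Z - 1) < (n k)%:R <= (2 : R) ^ j%:Z) =
    ((2 ^ j < 2 * n k) && (n k <= 2 ^ j))%N.
  rewrite expfzDr// exprN1 -exprnP -natrX ler_nat; congr andb.
  by rewrite ltr_pdivrMr// -natrM ltr_nat mulnC.
by split=> k /= [k1]; rewrite E.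
Qed.

Context (n_mono : forall k, (1 <= k)%N -> (n k <= n k.+1)%N).

Lemma n_homo i j : (1 <= i)%N -> (i <= j)%N -> (n i <= n j)%N.
Proof.
move=> i1; elim: j => [|j IH]; first by rewrite leqNgt i1.
rewrite leq_eqVlt => /predU1P[<-//|ij].
by rewrite (leq_trans (IH ij))// n_mono// (leq_trans i1).
Qed.

(** By monotonicity the indices of one dyadic block form an interval, and an interval with more than
    [k0 + D + 2] elements contains [D] consecutive ones past [k0]. *)
Lemma long_dyadic_run :
    ereal_sup [set dyadic_count (R := R) n j | j in [set: nat]] = +oo%E ->
  forall D k0, exists K, exists2 J, (k0 <= K)%N & forall k, (K <= k < K + D)%N ->
    (2 ^ J < 2 * n k.+1)%N /\ (n k.+1 <= 2 ^ J)%N.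
Proof.
move=> supE D k0; pose c := (k0 + D + 2)%N.
have [j hj] : exists j, (c%:R%:E < dyadic_count n j :> \bar R)%E.
  apply: contrapT => h.
  suff : (ereal_sup [set dyadic_count (R := R) n j | j in [set: nat]] <= c%:R%:E)%E.
    by rewrite supE leye_eq.
  apply: ge_ereal_sup => _ [j _ <-]; rewrite leNgt; apply/negP => lt.
  by apply: h; exists j.
rewrite dyadic_countE in hj.
have Xne : exists k, `[< dyadic_block j k >].
  apply: contrapT => h; move: hj; apply/negP; rewrite -leNgt.
  apply: le_trans (@counting_le _ [::] _) _; last by rewrite lee_fin ler_nat.
  by move=> k Xk; case: h; exists k; apply/asboolP.
pose x0 := ex_minn Xne.
have [X0 x0min] : dyadic_block j x0 /\ forall k, dyadic_block j k -> (x0 <= k)%N.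
  by rewrite /x0; case: ex_minnP => m /asboolP Xm h; split=> // k Xk; apply/h/asboolP.
have [b [Xb bx]] : exists b, dyadic_block j b /\ (x0 + c <= b)%N.
  apply: contrapT => h; move: hj; apply/negP; rewrite -leNgt.
  apply: le_trans (@counting_le _ (iota x0 c) _) _; last by rewrite size_iota.
  move=> k Xk /=; rewrite mem_iota x0min//= ltnNge; apply/negP => ck.
  by apply: h; exists k.
exists (x0 + k0)%N, j; first exact: leq_addl.
move=> k /andP[k1 k2]; case: X0 => x1 /andP[X0 _]; case: Xb => b1 /andP[_ Xb].
have h1 : (n x0 <= n k.+1)%N by apply: n_homo => //; lia.
have h2 : (n k.+1 <= n b)%N by apply: n_homo => //; rewrite /c in bx; lia.
by split; lia.
Qed.

(** Let [D] bound all the counts. If the inequality failed, the [D.+1] indices from [k.+1] to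
    [(k + D).+1] would share a dyadic block. *)
Lemma short_dyadic_run :
    (ereal_sup [set dyadic_count (R := R) n j | j in [set: nat]] < +oo)%E ->
  exists D, forall k J, (2 ^ J < 2 * n k.+1)%N -> (n k.+1 <= 2 ^ J)%N ->
    (2 ^ J < n (k + D).+1)%N.
Proof.
move=> supE.
have [D hD] : exists D : nat, forall j, (dyadic_count n j <= D%:R%:E :> \bar R)%E.
  have ub j : (dyadic_count n j <=
      ereal_sup [set dyadic_count (R := R) n j | j in [set: nat]])%E.
    by apply: ereal_sup_ubound; exists j.
  case: (ereal_sup _) supE ub => [r _ ub|//|_ ub].
    exists (Num.bound r) => j; rewrite (le_trans (ub j))// lee_fin.
    have [r0|r0] := leP 0 r; first by rewrite ltW// archi_boundP.
    by rewrite (le_trans (ltW r0)).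
  by exists 0%N => j; rewrite (le_trans (ub j))// leNye.
exists D => k J h1 h2; rewrite ltnNge; apply/negP => h3.
have := hD J; rewrite dyadic_countE; apply/negP; rewrite -ltNge.
apply: lt_le_trans (@counting_ge _ (iota k.+1 D.+1) _ _).
- by rewrite size_iota lte_fin ltr_nat.
- exact: iota_uniq.
- move=> i ir; have : i \in iota k.+1 D.+1 by [].
  rewrite mem_iota => /andP[ki iD]; split; first by lia.
  have a1 : (n k.+1 <= n i)%N by exact: n_homo.
  have a2 : (n i <= n (k + D).+1)%N by apply: n_homo; lia.
  by apply/andP; split; lia.
Qed.

End dyadic_blocks.

(** * The stable rank for unbounded and for bounded counts *)

Theorem theorem6p1 (R : realType) (H : completeNormedModType R[i])
    (dot : {dot H for conjC}) (hdot : hilbert_product dot)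
    (N : omega_nest H) (n : nat -> nat)
    (hn : forall k, (1 <= k)%N -> has_dim (atom dot N k) (n k))
    (n_mono : forall k, (1 <= k)%N -> (n k <= n k.+1)%N) :
  (ereal_sup [set dyadic_count (R := R) n j | j in [set: nat]] = +oo%E ->
     rtsr (nest_banach_algebra N) = +oo%E) /\
  ((ereal_sup [set dyadic_count (R := R) n j | j in [set: nat]] < +oo)%E ->
     rtsr (nest_banach_algebra N) = 2%:R%:E).
Proof.
have [e [s [eo s0 sS n_gt0 NE]]] := exists_nest_basis hn.
have s_lt k : (s k < s k.+1)%N by rewrite sS -{1}[s k]addn0 ltn_add2l.
have sB k : (s k.+1 - s k = n k.+1)%N by rewrite sS addKn.
split=> hsup.
  (* No row length is admissible: 0 is excluded by definition, and rows of length [m.+1] are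
     obstructed by [m.+1] simultaneous shifts. *)
  rewrite /rtsr; case: pselect => // ex; exfalso.
  move: ex => [[|m] /asboolP[//]] _.
  have [|f [finj flev fL]] := @many_shifts_obstruction s s0 s_lt m.
    move=> D k0; have [K [J k0K hJ]] := long_dyadic_run n_mono hsup D k0.
    by exists K, J => // k; rewrite sB; exact: hJ.
  exact: (not_dense_of_partial_injections hdot eo NE finj flev fL).
have b2 : rtsr_bound (nest_banach_algebra N) 2.
  split=> //; have [D hD] := short_dyadic_run n_mono hsup.
  have [||q hq] := @exists_domination_shift s s0 s_lt D.
  - by move=> k; rewrite !sB n_mono.
  - by move=> k J; rewrite !sB; exact: hD.
  exact: (dense_right_unimodular2 hdot eo NE s0 s_lt hq).
have nb1 : ~ rtsr_bound (nest_banach_algebra N) 1.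
  move=> [_]; have [f [finj flev fL]] := one_shift_obstruction s0 s_lt.
  exact: (not_dense_of_partial_injections hdot eo NE finj flev fL).
rewrite /rtsr; case: pselect => [ex|[]]; last by exists 2%N; apply/asboolP.
case: ex_minnP => m /asboolP hm /(_ 2%N) m2.
have {}m2 : (m <= 2)%N by apply/m2/asboolP.
by case: m hm m2 => [[]//|[/nb1//|[|]]].
Qed.
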